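(* Assume that one of the following two conditions holds: (i) (K1), (K3)$'$, (K4), (K6), (K7)$'$, (K8), (K9) hold and $$\kappa:=\inf_{p\in\mathbf R}\inf_{x\in\mathbf R}\int_{\mathbf R}K(x,y)e^{p(y-x)}\,dy-\sup_{x\in\mathbf R}a(x)+\inf_{x\in\mathbf R}a(x)>0;$$ (ii) (K1), (K3)$'$, (K4), (K7), (K9) hold and $K(x,y)=K(x-y)$ (i.e. $K$ depends only on $x-y$). If moreover $K\varphi$ is uniformly continuous for every $\varphi\in L^\infty(\mathbf R)\cap C(\mathbf R)$, then $$\underline\omega=\overline\omega.$$ (All conditions and the numbers $\underline\omega,\overline\omega$ are defined in the context.)
   Context: Setting. $K(x,y)\ge 0$ on $\mathbf R^2$; $K\phi(x):=\int_{\mathbf R}K(x,y)\phi(y)\,dy$; $b(x):=\int_{\mathbf R}K(x,y)\,dy$; $K_p(x,y):=K(x,y)e^{p(y-x)}$ for $p\in\mathbf R$. The function $f:\mathbf R\times[0,1]\to\mathbf R$ satisfies $f(x,0)\equiv f(x,1)\equiv 0$; $0<\inf_{x}f(x,s)\le f(x,s)\le f_s'(x,0)s$ for $s\in(0,1)$; $f_s'(\cdot,0)\in C(\mathbf R)$; $\sup_{x}\|f(x,\cdot)\|_{\mathcal C^{1+\gamma}([0,1])}<+\infty$ for some $\gamma>0$. Put $a(x):=b(x)-f_s'(x,0)$, and, for $p\in\mathbf R$, $\underline c=\inf_x\{\int_{\mathbf R}K_p(x,y)\,dy-a(x)\}$, $\overline c=\sup_x\{\int_{\mathbf R}K_p(x,y)\,dy-a(x)\}$.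 $B_r(x)$ is the open interval of radius $r$ about $x$, $B_r^c(x)$ its complement. Conditions (those involving $p$ are required for every $p\in\mathbf R$). (K1) $K$ maps $C(\mathbf R)$ to $C(\mathbf R)$, and $x\mapsto\int_{\mathbf R}K(x,x-\xi)e^{-p\xi}\,d\xi$ belongs to $L^\infty(\mathbf R)\cap C(\mathbf R)$ for every $p$. (K3)$'$ There are $\theta_0,\Delta,k_0>0$ with $K(x,y)\ge\theta_0$ for $|x-y|\le\Delta$ and $K(x,y)\le k_0$ for all $(x,y)$. (K4) $k(p):=\liminf_{R\to\infty}\inf_{|x|\ge R}\{\int_{\mathbf R}K(x,x-\xi)e^{-p\xi}\,d\xi-b(x)+f_s'(x,0)\}>0$ for all $p$, and $\lim_{p\to+\infty}k(\pm p)/p=\lim_{p\to0^+}k(\pm p)/p=+\infty$. (K6) For every $R>0$, $\int_{B_R(0)}|K_p(x,x-s)-K_p(x+\xi,x+\xi-s)|\,ds\to0$ as $|\xi|\to0$, uniformly in $x\in\mathbf R$. (K7) There exist $\varepsilon_0>0$ and $r(\varepsilon)>0$ such that $\alpha_p:=\sup_{x\in\mathbf R,\ \varepsilon\in(0,\varepsilon_0]}\frac{\int_{B_{r(\varepsilon)}^c(x)}K_p(x,y)\,dy}{\int_{\mathbf R}K_p(x,y)\,dy}\exp\big(\frac{\overline c-\underline c}{\varepsilon}\big)<1$ and $\varepsilon r(\varepsilon)\to0$ as $\varepsilon\to0^+$. (K7)$'$ There is $r_0>\Delta$ such that $K(x,y)=0$ if $|x-y|\ge r_0$. (K8) Every sequence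 $\{x_n\}\subset\mathbf R$ has a subsequence (still denoted $x_n$) such that $\int_{B_{r_0}(0)}|K_p(x+x_n,x+x_n-s)-K_p(x+x_m,x+x_m-s)|\,ds\to0$ as $n,m\to\infty$, uniformly in $x\in\mathbf R$. (K9) $a$ is almost periodic: for every sequence $x_n$ there is a subsequence $x_{n_k}$ such that $a(\cdot+x_{n_k})$ converges uniformly on $\mathbf R$. Generalized principal eigenvalues. $L_p\phi(x)=\int_{\mathbf R}K(x,y)e^{p(y-x)}\phi(y)\,dy-a(x)\phi(x)$. $\mathcal A$ is the set of uniformly continuous $\phi\in C(\mathbf R)$ with $0<\inf_{\mathbf R}\phi\le\sup_{\mathbf R}\phi<+\infty$. For $R\in\{-\infty\}\cup\mathbf R$, $I_R=(R,+\infty)$, $\underline{\lambda_1}(p,R)=\sup\{\lambda:\exists\phi\in\mathcal A,\ L_p\phi\ge\lambda\phi\text{ on }I_R\}$, $\overline{\lambda_1}(p,R)=\inf\{\lambda:\exists\phi\in\mathcal A,\ L_p\phi\le\lambda\phi\text{ on }I_R\}$. Set $\underline H(p)=\lim_{R\to+\infty}\underline{\lambda_1}(p,R)$, $\overline H(p)=\lim_{R\to+\infty}\overline{\lambda_1}(p,R)$ (monotone limits), and $\underline\omega=\min_{p>0}\underline H(-p)/p$, $\overline\omega=\min_{p>0}\overline H(-p)/p$. *)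

(* Defs.v *)
(* MathComp-Analysis; integrals are Lebesgue integrals over an arbitrary [realType]. *)
From mathcomp Require Import all_boot all_order all_algebra.
From mathcomp Require Import all_classical all_reals all_analysis.

Set Implicit Arguments.
Unset Strict Implicit.
Unset Printing Implicit Defensive.

Import Order.TTheory GRing.Theory Num.Theory.
Import numFieldNormedType.Exports.

Local Open Scope classical_set_scope.
Local Open Scope ring_scope.

Section Defs.
Context {R : realType}.
Notation mu := (@lebesgue_measure R).

Implicit Types (K f : R -> R -> R) (g a phi : R -> R) (p : R).

Definition I01 : set R := `[0, 1].

(* Derivative relative to the segment [0, 1], one-sided at the endpoints; the
   values of [g] outside [0, 1] are irrelevant. *)
Definition diff_quot g (s t : R) : R := (t - s)^-1 * (g t - g s).

Definition seg_derivable g (s : R) : Prop :=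
  cvg (diff_quot g s t @[t --> within I01 s^']).

Definition seg_deriv g (s : R) : R :=
  lim (diff_quot g s t @[t --> within I01 s^']).

(* The C^{1+gamma}([0, 1]) norm, for 0 < gamma <= 1. *)
Definition C1gamma_norm (gamma : R) g : \bar R :=
  (ereal_sup [set `|g s|%:E | s in I01]
   + ereal_sup [set `|seg_deriv g s|%:E | s in I01]
   + ereal_sup [set e | exists s t, [/\ I01 s, I01 t, s != t &
       e = (`|seg_deriv g s - seg_deriv g t| / (`|s - t| `^ gamma))%:E]])%E.

Definition fs0 f (x : R) : R := seg_deriv (f x) 0.

(* A function on R x [0, 1] is encoded by [f : R -> R -> R], whose values for a
   second argument outside [0, 1] are never used. *)
Definition nonlinearity f : Prop :=
  [/\ forall x, f x 0 = 0 /\ f x 1 = 0,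
      forall s, 0 < s < 1 -> (0 < ereal_inf (range (fun x => (f x s)%:E)))%E,
      forall x s, 0 < s < 1 -> f x s <= fs0 f x * s,
      continuous (fs0 f) &
      exists gamma, [/\ 0 < gamma <= 1,
        forall x s, I01 s -> seg_derivable (f x) s &
        (ereal_sup (range (fun x => C1gamma_norm gamma (f x))) < +oo)%E]].

Definition Kop K phi (x : R) : R := \int[mu]_y (K x y * phi y).

Definition Kp K p (x y : R) : R := K x y * expR (p * (y - x)).

Definition b_ K (x : R) : R := \int[mu]_y K x y.

Definition a_ K f (x : R) : R := b_ K x - fs0 f x.

Definition intKp K p (x : R) : R := \int[mu]_y Kp K p x y.

Definition intKexp K p (x : R) : R :=
  \int[mu]_xi (K x (x - xi) * expR (- p * xi)).

(* The real [inf] and [sup] are meaningful here because [K1] and [nonlinearity]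
   make the function bounded. *)
Definition c_low K f p : R := inf (range (fun x => intKp K p x - a_ K f x)).
Definition c_up K f p : R := sup (range (fun x => intKp K p x - a_ K f x)).

(* The R-valued integral is 0 on non-integrable functions, so that finiteness of an
   integral is expressed by integrability. "K maps C(R) to C(R)" is understood
   on the natural domain of the integral operator. *)
Definition K1 K : Prop :=
  [/\ forall phi, continuous phi ->
        (forall x, mu.-integrable setT (fun y => (K x y * phi y)%:E)) ->
        continuous (Kop K phi),
      forall p x,
        mu.-integrable setT (fun xi => (K x (x - xi) * expR (- p * xi))%:E) &
      forall p, bounded_fun (intKexp K p) /\ continuous (intKexp K p)].

Definition K3' K (theta0 Delta k0 : R) : Prop :=
  [/\ 0 < theta0, 0 < Delta, 0 < k0,
      forall x y, `|x - y| <= Delta -> theta0 <= K x y &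
      forall x y, K x y <= k0].

Definition k_ K f p : \bar R :=
  limf_einf (fun r : R => ereal_inf
    [set (intKexp K p x - b_ K x + fs0 f x)%:E | x in [set x | r <= `|x|]])
    (pinfty_nbhs R).

Definition K4 K f : Prop :=
  (forall p, (0 < k_ K f p)%E) /\
  (forall sg : R, sg = 1 \/ sg = -1 ->
    (((k_ K f (sg * p) * (p^-1)%:E)%E @[p --> pinfty_nbhs R] --> +oo%E) /\
     ((k_ K f (sg * p) * (p^-1)%:E)%E @[p --> 0^'+] --> +oo%E))).

Definition Kp_dist K p (r x x' : R) : \bar R :=
  (\int[mu]_(s in ball (0 : R)%R r)
     (`|Kp K p x (x - s) - Kp K p x' (x' - s)|%R)%:E)%E.

Definition K6 K : Prop :=
  forall p (r : R), 0 < r -> forall e : R, 0 < e ->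
    \forall xi \near (0 : R), forall x : R,
      (Kp_dist K p r x (x + xi)%R < e%:E)%E.

Definition alpha_ K f p (eps0 : R) (r : R -> R) : \bar R :=
  ereal_sup [set ((\int[mu]_(y in ~` ball x (r eps)) Kp K p x y)
                   / intKp K p x
                   * expR ((c_up K f p - c_low K f p) / eps))%:E
            | x in [set: R] & eps in `]0, eps0]].

Definition K7 K f : Prop :=
  forall p, exists (eps0 : R) (r : R -> R),
    [/\ 0 < eps0,
        forall eps, 0 < eps -> 0 < r eps,
        (alpha_ K f p eps0 r < 1)%E &
        eps * r eps @[eps --> 0^'+] --> 0].

Definition K7' K (Delta r0 : R) : Prop :=
  Delta < r0 /\ forall x y, r0 <= `|x - y| -> K x y = 0.

Definition extraction (sigma : nat -> nat) : Prop :=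
  {homo sigma : m n / (m < n)%N}.

Definition K8 K (r0 : R) : Prop :=
  forall p (u : nat -> R), exists2 sigma, extraction sigma &
    forall e : R, 0 < e -> exists N : nat, forall n m, (N <= n)%N -> (N <= m)%N ->
      forall x : R,
        (Kp_dist K p r0 (x + u (sigma n))%R (x + u (sigma m))%R < e%:E)%E.

Definition K9 a : Prop :=
  forall u : nat -> R, exists2 sigma, extraction sigma &
    exists l : R -> R,
      {uniform, (fun n x => a (x + u (sigma n))) @ \oo --> l}.

Definition kappa K f : \bar R :=
  (ereal_inf (range (fun p => ereal_inf (range (fun x => (intKp K p x)%:E))))
   - ereal_sup (range (fun x => (a_ K f x)%:E))
   + ereal_inf (range (fun x => (a_ K f x)%:E)))%E.

Definition condition_i K f : Prop :=
  exists theta0 Delta k0 r0 : R,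
    [/\ K1 K, K3' K theta0 Delta k0, K4 K f & K6 K] /\
    [/\ K7' K Delta r0, K8 K r0, K9 (a_ K f) & (0 < kappa K f)%E].

Definition condition_ii K f : Prop :=
  (exists theta0 Delta k0 : R,
    [/\ K1 K, K3' K theta0 Delta k0, K4 K f, K7 K f & K9 (a_ K f)]) /\
  (exists J : R -> R, forall x y, K x y = J (x - y)).

Definition Lop K a p phi (x : R) : R :=
  \int[mu]_y (K x y * expR (p * (y - x)) * phi y) - a x * phi x.

Definition calA : set (R -> R) :=
  [set phi | [/\ unif_continuous phi,
    (0 < ereal_inf (range (fun x => (phi x)%:E)))%E &
    (ereal_sup (range (fun x => (phi x)%:E)) < +oo)%E]].

(* I_r; the case r = -oo is allowed. *)
Definition halfline (r : \bar R) : set R := [set x | (r < x%:E)%E].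

Definition lambda1_low K a p (r : \bar R) : \bar R :=
  ereal_sup [set lam%:E | lam in [set lam : R | exists2 phi, calA phi &
    forall x, halfline r x -> lam * phi x <= Lop K a p phi x]].

Definition lambda1_up K a p (r : \bar R) : \bar R :=
  ereal_inf [set lam%:E | lam in [set lam : R | exists2 phi, calA phi &
    forall x, halfline r x -> Lop K a p phi x <= lam * phi x]].

(* The limits below exist since the functions are monotone in [r]. *)
Definition H_low K a p : \bar R :=
  lim (lambda1_low K a p r%:E @[r --> pinfty_nbhs R]).

Definition H_up K a p : \bar R :=
  lim (lambda1_up K a p r%:E @[r --> pinfty_nbhs R]).

Definition is_min (S : set (\bar R)) (w : \bar R) : Prop := S w /\ lbound S w.

(* omega is a minimum, not merely an infimum: attainment is part of the meaning. *)
Definition is_omega_low K a (w : R) : Prop :=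
  is_min [set (H_low K a (- p) * (p^-1)%:E)%E | p in [set p : R | 0 < p]] w%:E.

Definition is_omega_up K a (w : R) : Prop :=
  is_min [set (H_up K a (- p) * (p^-1)%:E)%E | p in [set p : R | 0 < p]] w%:E.

End Defs.

(* Main.v *)
(* Fix p and write T for the integral operator with kernel K_p, G = T + (c - a), c - a >= 1.
   The discounted problem u = (1 - e) ln G(exp u) is solvable because phi |-> ln G(exp phi) is
   nonexpansive. With phi = exp u and v = ln G(phi) - u, one has T phi - a phi = (exp v - c) phi
   and v is e u / (1 - e) up to O(e), so phi is an approximate eigenfunction as soon as e u has
   small oscillation. On bounded distances this is a weak Harnack inequality, with a loss
   exp(s / e), obtained by chaining over about 1 / e steps. Globally it follows from almost
   periodicity: translating the equation by an almost period of a and K perturbs e u only slightly,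
   provided the change of kernel is controlled by phi itself. In case (ii) the kernel does not
   change; in case (i) kappa > 0 and the compact support give a Harnack constant independent of e.
   Approximate eigenfunctions and a comparison principle on half-lines pin both generalized
   eigenvalues, on every half-line, to the same real H(p). It is continuous in p and at least k(p),
   so (K4) makes H(-p) / p coercive on (0, +oo) and its minimum is attained. *)
Require Import Defs.
From mathcomp Require Import all_boot all_order all_algebra.
From mathcomp Require Import all_classical all_reals all_analysis.
From mathcomp Require Import measurable_realfun.
From mathcomp Require Import ring lra.

Set Implicit Arguments.
Unset Strict Implicit.
Unset Printing Implicit Defensive.

Import Order.TTheory GRing.Theory Num.Theory.
Import numFieldNormedType.Exports.

Local Open Scope classical_set_scope.
Local Open Scope ring_scope.

(** The obstacle is the order in which parameters are fixed. The tolerance [s] decides how close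
    almost periods must be, these decide a finite net and its diameter, and only then may [e] be
    taken small. So the constant [CH] that converts a change of kernel into a multiple of [phi] must
    be known before [e], and the loss [exp (s / e)] of the weak Harnack inequality is useless there;
    hence the separate treatment of the two cases. The number of chaining steps is forced as well. A
    discounted solution may be as large as [exp (b1 / e)], so the kernel can be cut off only at a
    radius of order [1 / e], where its tail is at most a multiple of [exp (- b1 / e)]. Crossing a
    radius [rho * h / e] costs [exp (O(rho) / e)], harmless for small [rho]; the decay rate needed
    grows like [1 / rho], and integrability of [K_p] for every [p] supplies every rate. *)

Notation leb := lebesgue_measure.
Notation ig f := (leb.-integrable setT (fun x => (f x)%:E)).

(** * Integration on the line: domination, window indicators, reflection *)

Section real_integral.
Context {R : realType}.
Implicit Types (f g : R -> R).
Local Notation mu := (@lebesgue_measure R).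
Local Notation "'I' f" := (\int[mu]_x f x) (at level 10, f at level 9).

Lemma integrable_measurable f : ig f -> measurable_fun setT f.
Proof. by move=> /measurable_int/measurable_EFinP. Qed.

Lemma integrable_dominated f g : measurable_fun setT f ->
  (forall x, `|f x| <= g x) -> ig g -> ig f.
Proof.
move=> mf fg; apply: le_integrable => //; first exact/measurable_EFinP.
by move=> x _ /=; rewrite lee_fin (le_trans (fg x))// ler_norm.
Qed.

Lemma integrable_add f g : ig f -> ig g -> ig (fun x => f x + g x).
Proof. by move=> hf hg; apply: (integrableD _ hf hg). Qed.

Lemma integrable_scale c f : ig f -> ig (fun x => c * f x).
Proof. by move=> hf; apply: (integrableZl _ c hf). Qed.

Lemma integrable_mulb f g c : ig f -> measurable_fun setT g ->
  (forall x, `|g x| <= c) -> ig (fun x => f x * g x).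
Proof.
move=> hf mg gc; apply: (@integrable_dominated _ (fun x => c * `|f x|)).
- by apply: measurable_funM => //; exact: integrable_measurable.
- by move=> x; rewrite normrM mulrC ler_wpM2r.
- apply: integrable_scale.
  exact: (integrable_abse hf).
Qed.

Lemma integrable_norm_sub f g : ig f -> ig g -> ig (fun x => `|f x - g x|).
Proof.
by move=> hf hg; exact: (integrable_abse (integrableB _ hf hg)).
Qed.

Lemma int_add f g : ig f -> ig g -> I (fun x => f x + g x) = I f + I g.
Proof. exact: RintegralD. Qed.

Lemma int_sub f g : ig f -> ig g -> I (fun x => f x - g x) = I f - I g.
Proof. exact: RintegralB. Qed.

Lemma int_scale c f : ig f -> I (fun x => c * f x) = c * I f.
Proof. by move=> hf; apply: RintegralZl. Qed.

Lemma int_le f g : ig f -> ig g -> (forall x, f x <= g x) -> I f <= I g.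
Proof. by move=> hf hg fg; apply: le_Rintegral. Qed.

Lemma int_ge0 f : (forall x, 0 <= f x) -> 0 <= I f.
Proof. by move=> f0; apply: Rintegral_ge0. Qed.

Lemma int_ext f g : f =1 g -> I f = I g.
Proof. by move=> fg; apply: eq_Rintegral => x _. Qed.

Lemma norm_int_le f g : ig f -> ig g -> (forall x, `|f x| <= g x) ->
  `|I f| <= I g.
Proof.
move=> hf hg fg; apply: (le_trans (le_normr_Rintegral _ hf)) => //.
by apply: int_le => //; exact: (integrable_abse hf).
Qed.

(** Defined by cases so that pointwise inequalities between windows reduce to linear arithmetic. *)
Definition chi (a b y : R) : R := if a <= y <= b then 1 else 0.

Lemma chiE a b : chi a b = \1_(`[a, b]).
Proof.
apply/funext => y; rewrite /chi indicE.
have -> : (y \in `[a, b]%classic) = (a <= y <= b).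
  by apply/idP/idP; rewrite inE /= in_itv.
by case: ifP.
Qed.

Lemma chi_ge0 a b y : 0 <= chi a b y.
Proof. by rewrite /chi; case: ifP. Qed.

Lemma chi_le1 a b y : chi a b y <= 1.
Proof. by rewrite /chi; case: ifP. Qed.

Lemma measurable_chi a b : measurable_fun setT (chi a b).
Proof. by rewrite chiE. Qed.

Lemma integrable_chi a b : ig (chi a b).
Proof.
by rewrite chiE; exact: (integrable_indic_itv a b true false).
Qed.

Lemma int_chi a b : a <= b -> I (chi a b) = b - a.
Proof.
move=> ab; rewrite chiE /Rintegral integral_indic// setIT.
have : mu `[a, b] = if a < b then (b - a)%:E else 0%E.
  by rewrite lebesgue_measure_itv /= lte_fin EFinB.
move=> /(congr1 fine) H; rewrite [LHS]H; case: ltP => [//|ba]; apply/esym/eqP; rewrite subr_eq0.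
by rewrite eq_le ba ab.
Qed.

Let subx_measurable (x : R) :
  measurable_fun setT (fun s : R => x - s : measurableTypeR R).
Proof. exact: measurable_funB. Qed.

(** Lebesgue measure is determined by half-open intervals, and the reflection pulls []a, b]] back to
    [[x - b, x - a[], of the same length. *)
Let pushforward_subx (x : R) (A : set R) : measurable A ->
  mu A = pushforward mu (fun s : R => x - s : measurableTypeR R) A.
Proof.
move=> mA; apply: lebesgue_measure_unique => //=; first exact: subx_measurable.
move=> _ _ [[a b]] _ <-.
rewrite /pushforward.
have -> : (fun s : R => x - s) @^-1` `]a, b]%classic = `[x - b, x - a[%classic.
  by apply/seteqP; split=> s /=; rewrite !in_itv/= => /andP[? ?]; apply/andP; split; lra.
rewrite !lebesgue_measure_itv/= !lte_fin.
rewrite [x - b < x - a](_ : _ = (a < b)); last by apply/idP/idP => ?; lra.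
by case: ifP => // _; rewrite -EFinB; congr _%:E; lra.
Qed.

Lemma integrable_reflect (x : R) f : ig f -> ig (fun s => f (x - s)).
Proof.
move=> hf; have mf := measurable_int _ hf.
move/integrableP : hf => [_ foo]; apply/integrableP; split.
  exact: (measurableT_comp mf (subx_measurable x)).
apply: le_lt_trans foo.
rewrite [leRHS](@eq_measure_integral _ _ _ _
  (pushforward mu (fun s : R => x - s : measurableTypeR R))).
- exact: subx_measurable.
- by move=> mH; rewrite ge0_integral_pushforward//; exact: measurableT_comp.
- by move=> ? A mA _; exact: pushforward_subx.
Qed.

Lemma int_reflect (x : R) f : ig f -> I (fun s => f (x - s)) = I f.
Proof.
move=> hf; rewrite /Rintegral; congr fine.
rewrite [RHS](@eq_measure_integral _ _ _ _
  (pushforward mu (fun s : R => x - s : measurableTypeR R))).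
- exact: subx_measurable.
- move=> mH; rewrite integral_pushforward//; first exact: measurable_int hf.
  exact: integrable_reflect.
- by move=> ? A mA _; exact: pushforward_subx.
Qed.

End real_integral.

(** * Uniformly continuous functions; Lipschitz bounds for [ln] and [expR] *)

Section uniform_continuity.
Context {R : realType}.
Implicit Types u v phi : R -> R.

Definition ucont u := forall e : R, 0 < e -> exists2 d : R, 0 < d &
    forall x y, `|x - y| < d -> `|u x - u y| <= e.

Definition bounded_ucont u := ucont u /\ exists M, forall x, `|u x| <= M.

Lemma ucont_continuous u : ucont u -> continuous u.
Proof.
move=> hu x; apply/cvgrPdist_le => e e0; have [d d0 hd] := hu e e0.
by apply/nbhs_ballP; exists d => //= y; exact: hd.
Qed.

Lemma ucont_measurable u : ucont u -> measurable_fun setT u.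
Proof. by move=> hu; apply: continuous_measurable_fun; exact: ucont_continuous. Qed.

Lemma ucont_unif_continuous u : ucont u -> unif_continuous u.
Proof.
move=> hu; apply/unif_continuousP => e e0 /=.
have e2 : 0 < e / 2 by rewrite divr_gt0.
have [d d0 hd] := hu _ e2; exists d => //= -[x y] /hd h.
by apply: (le_lt_trans h); rewrite ltr_pdivrMr // ltr_pMr// ltr1n.
Qed.

Lemma bounded_ucont_cst (k : R) : bounded_ucont (cst k).
Proof.
split; last by exists `|k|.
by move=> e e0; exists 1 => // x y _; rewrite subrr normr0 ltW.
Qed.

Lemma ucont_comp_lipschitz u (f : R -> R) (k : R) : 0 <= k -> ucont u ->
  (forall x y, `|f (u x) - f (u y)| <= k * `|u x - u y|) -> ucont (f \o u).
Proof.
move=> k0 hu hf e e0; have k1 : 0 < k + 1 by lra.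
have [d d0 hd] := hu (e / (k + 1)) (divr_gt0 e0 k1).
exists d => // x y /hd h /=; apply: (le_trans (hf x y)).
apply: (@le_trans _ _ ((k + 1) * (e / (k + 1)))); last by rewrite mulrC divfK ?gt_eqF.
by apply: ler_pM => //; lra.
Qed.

Lemma ucont_add u v : ucont u -> ucont v -> ucont (fun x => u x + v x).
Proof.
move=> hu hv e e0; have e2 : 0 < e / 2 by lra.
have [d1 d10 h1] := hu _ e2; have [d2 d20 h2] := hv _ e2.
exists (Num.min d1 d2); first by rewrite lt_min d10.
move=> x y; rewrite lt_min => /andP[/h1 ? /h2 ?].
rewrite opprD addrACA; apply: (le_trans (ler_normD _ _)); lra.
Qed.

Lemma ucont_mul u v M : ucont u -> ucont v -> (forall x, `|u x| <= M) ->
  (forall x, `|v x| <= M) -> ucont (fun x => u x * v x).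
Proof.
move=> hu hv hM hM' e e0.
have M0 : 0 <= M := le_trans (normr_ge0 _) (hM 0).
have M1 : 0 < M + 1 by lra.
have e2 : 0 < e / (M + 1) / 2 by rewrite !divr_gt0.
have [d1 d10 h1] := hu _ e2; have [d2 d20 h2] := hv _ e2.
exists (Num.min d1 d2); first by rewrite lt_min d10.
move=> x y; rewrite lt_min => /andP[/h1 k1 /h2 k2].
have -> : u x * v x - u y * v y = u x * (v x - v y) + (u x - u y) * v y by ring.
apply: (le_trans (ler_normD _ _)); rewrite !normrM.
have A1 : `|u x| * `|v x - v y| <= (M + 1) * (e / (M + 1) / 2).
  by apply: ler_pM => //; have := hM x; lra.
have A2 : `|u x - u y| * `|v y| <= (e / (M + 1) / 2) * (M + 1).
  by apply: ler_pM => //; have := hM' y; lra.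
have E : (M + 1) * (e / (M + 1) / 2) = e / 2 by field; rewrite gt_eqF.
rewrite mulrC in A2; rewrite E in A1 A2; lra.
Qed.

Lemma ln_sub_le (x y m : R) : 0 < m -> m <= x -> m <= y -> `|ln x - ln y| <= `|x - y| / m.
Proof.
move=> m0; wlog xy : x y / x <= y.
  move=> H mx my; have [xy|/ltW yx] := leP x y; first exact: H.
  by rewrite distrC [`|x - y|]distrC; exact: H.
move=> mx my; have x0 : 0 < x by lra.
have y0 : 0 < y by lra.
rewrite ler0_norm; last by rewrite subr_le0 ler_ln.
rewrite ler0_norm ?subr_le0// !opprB -ln_div //.
have -> : y / x = 1 + (y - x) / x by field; rewrite gt_eqF.
have h : 0 <= (y - x) / x by apply: divr_ge0; lra.
apply: (@le_trans _ _ ((y - x) / x)).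
  by apply: le_ln1Dx; lra.
by rewrite ler_wpM2l ?subr_ge0// lef_pV2 // posrE.
Qed.

Lemma expR_sub_le (x y M : R) : x <= M -> y <= M -> `|expR x - expR y| <= expR M * `|x - y|.
Proof.
wlog xy : x y / x <= y.
  move=> H mx my; have [xy|/ltW yx] := leP x y; first exact: H.
  by rewrite distrC [`|x - y|]distrC; exact: H.
move=> mx my; rewrite ler0_norm ?subr_le0 ?ler_expR// ler0_norm ?subr_le0// !opprB.
have h : expR x >= expR y * (1 + (x - y)).
  have -> : expR x = expR y * expR (x - y) by rewrite -expRD; congr expR; ring.
  by rewrite ler_pM2l ?expR_gt0// expR_ge1Dx.
have h2 : expR y * (y - x) <= expR M * (y - x).
  by rewrite ler_wpM2r ?subr_ge0// ler_expR.
lra.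
Qed.

Lemma bounded_ucont_expR u : bounded_ucont u -> bounded_ucont (fun x => expR (u x)).
Proof.
move=> [hu [M hM]]; split.
  apply: (@ucont_comp_lipschitz u expR (expR M)) => //.
  by move=> x y; apply: expR_sub_le; rewrite (le_trans (ler_norm _)).
exists (expR M) => x; rewrite ger0_norm ?expR_ge0// ler_expR.
by rewrite (le_trans (ler_norm _)).
Qed.

End uniform_continuity.

(** * The discounted problem *)

Section discounted_problem.
Context {R : realType}.
Variables (N : R -> R -> R) (a : R -> R) (c M A : R).
Hypotheses (N0 : forall x s, 0 <= N x s) (iN : forall x, ig (N x)).
Hypotheses (NM : forall x, \int[leb]_s N x s <= M).
Hypotheses (Nuc : forall e : R, 0 < e -> exists2 d : R, 0 < d &
  forall x y, `|x - y| < d -> \int[leb]_s `|N x s - N y s| <= e).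
Hypotheses (auc : ucont a) (ca1 : forall x, 1 <= c - a x) (caA : forall x, c - a x <= A).
Implicit Types (u v phi psi : R -> R) (x B k : R).

(** The kernel is written in the displacement [s], so that a translation acts on the first argument
    of [N] only. *)
Definition convop phi (x : R) : R := \int[leb]_s (N x s * phi (x - s)).

Definition shiftop phi (x : R) : R := convop phi x + (c - a x) * phi x.

Definition logop u (x : R) : R := ln (shiftop (fun y => expR (u y)) x).

Lemma measurable_sub_reflect phi (x : R) : measurable_fun setT phi ->
  measurable_fun setT (fun s : R => phi (x - s)).
Proof.
move=> mphi.
have msub : measurable_fun setT (fun s : R => x - s) by exact: measurable_funB.
exact: (measurableT_comp mphi msub).
Qed.

Lemma integrable_convop phi x B : measurable_fun setT phi ->
  (forall y, `|phi y| <= B) -> ig (fun s => N x s * phi (x - s)).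
Proof.
by move=> mphi hB; apply: (@integrable_mulb _ _ _ B) => //; exact: measurable_sub_reflect.
Qed.

Lemma convop_le phi psi x B : measurable_fun setT phi -> measurable_fun setT psi ->
  (forall y, `|phi y| <= B) -> (forall y, `|psi y| <= B) ->
  (forall y, phi y <= psi y) -> convop phi x <= convop psi x.
Proof.
move=> m1 m2 b1 b2 le; apply: int_le; try exact: integrable_convop.
by move=> s; apply: ler_wpM2l.
Qed.

Lemma convop_scale phi x k B : measurable_fun setT phi -> (forall y, `|phi y| <= B) ->
  convop (fun y => k * phi y) x = k * convop phi x.
Proof.
move=> m1 b1; rewrite /convop -int_scale; last exact: integrable_convop.
by apply: int_ext => s; ring.
Qed.

Lemma convop_ge0 phi x : (forall y, 0 <= phi y) -> 0 <= convop phi x.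
Proof. by move=> h; apply: int_ge0 => s; apply: mulr_ge0. Qed.

Lemma M_ge0 : 0 <= M.
Proof. by apply: le_trans (NM 0); apply: int_ge0. Qed.

Lemma convop_bound phi x B : measurable_fun setT phi ->
  (forall y, `|phi y| <= B) -> `|convop phi x| <= M * B.
Proof.
move=> m1 b1; have B0 : 0 <= B := le_trans (normr_ge0 _) (b1 0).
apply: (@le_trans _ _ (\int[leb]_s (B * N x s))).
  apply: norm_int_le; [exact: integrable_convop|exact: integrable_scale|].
  by move=> s; rewrite normrM (ger0_norm (N0 _ _)) mulrC ler_wpM2r.
by rewrite int_scale// mulrC ler_wpM2r.
Qed.

(** The increment splits into a change of kernel, small in L1 by [Nuc], and a change of [phi] at
    fixed displacement [s]. *)
Lemma bounded_ucont_convop phi : bounded_ucont phi -> bounded_ucont (convop phi).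
Proof.
move=> [hu [B hB]]; have mphi := ucont_measurable hu; split; last first.
  by exists (M * B) => x; exact: convop_bound.
have B0 : 0 <= B := le_trans (normr_ge0 _) (hB 0).
have M0 := M_ge0.
move=> e e0.
have B1 : 0 < B + 1 by lra. have M1 : 0 < M + 1 by lra.
have [d1 d10 h1] := Nuc (divr_gt0 (divr_gt0 e0 (ltr0Sn _ 1)) B1).
have [d2 d20 h2] := hu _ (divr_gt0 (divr_gt0 e0 (ltr0Sn _ 1)) M1).
exists (Num.min d1 d2); first by rewrite lt_min d10.
move=> x y; rewrite lt_min => /andP[/h1 k1 xy].
have i1 := integrable_convop x mphi hB; have i2 := integrable_convop y mphi hB.
rewrite /convop -int_sub//.
set e1 := e / _ / (B + 1) in k1. set e2 := e / _ / (M + 1) in h2.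
have iabs : ig (fun s => `|N x s - N y s|) by exact: integrable_norm_sub.
apply: (@le_trans _ _ (\int[leb]_s (B * `|N x s - N y s| + e2 * N x s))).
  apply: norm_int_le.
  - exact: (integrableB _ i1 i2).
  - by apply: integrable_add; exact: integrable_scale.
  move=> s; have -> : N x s * phi (x - s) - N y s * phi (y - s) =
    (N x s - N y s) * phi (y - s) + N x s * (phi (x - s) - phi (y - s)) by ring.
  apply: (le_trans (ler_normD _ _)); rewrite !normrM (ger0_norm (N0 _ _)).
  rewrite lerD// mulrC; first by rewrite ler_wpM2r.
  rewrite ler_wpM2r// h2//; have -> : x - s - (y - s) = x - y by ring.
  by [].
rewrite int_add ?int_scale //; try exact: integrable_scale.
have hM := NM x.
have e20 : 0 < e2 by rewrite !divr_gt0.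
have E1 : e1 * (B + 1) = e / 2 by rewrite divfK ?gt_eqF.
have E2 : e2 * (M + 1) = e / 2 by rewrite divfK ?gt_eqF.
have P1 : B * \int[leb]_s `|N x s - N y s| <= (B + 1) * e1.
  by apply: ler_pM => //; [exact: int_ge0|lra].
have P2 : e2 * \int[leb]_s N x s <= e2 * (M + 1) by rewrite ler_wpM2l//; lra.
lra.
Qed.

Lemma bounded_ucont_shiftop phi : bounded_ucont phi -> bounded_ucont (shiftop phi).
Proof.
move=> hphi; have [h1 [B1 b1]] := bounded_ucont_convop hphi.
have [h2 [B2 b2]] := hphi.
have nc x : `|c - a x| <= A by rewrite ger0_norm ?caA //; have := ca1 x; lra.
have A0 : 0 <= A := le_trans (normr_ge0 _) (nc 0).
have B0 : 0 <= B2 := le_trans (normr_ge0 _) (b2 0).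
split.
  apply: ucont_add => //; apply: (@ucont_mul _ _ _ (A + B2)) => //.
  - move=> e e0; have [d d0 hd] := auc e0; exists d => // x y /hd.
    by rewrite (_ : c - a x - (c - a y) = - (a x - a y)) ?normrN//; ring.
  - by move=> x; have := nc x; lra.
  - by move=> x; have := b2 x; lra.
exists (B1 + A * B2) => x; apply: (le_trans (ler_normD _ _)).
by rewrite lerD// normrM ler_pM.
Qed.

(** This is the purpose of the shift: [c - a >= 1] makes the operator dominate the identity, and
    that lower bound makes its logarithm Lipschitz. *)
Lemma shiftop_ge phi x : (forall y, 0 <= phi y) -> phi x <= shiftop phi x.
Proof.
move=> h; have := convop_ge0 x h; rewrite /shiftop.
have : 1 * phi x <= (c - a x) * phi x by rewrite ler_wpM2r.
lra.
Qed.

Lemma shiftop_exp_gt0 u x : 0 < shiftop (fun y => expR (u y)) x.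
Proof.
apply: lt_le_trans (expR_gt0 (u x)) _.
by apply: (@shiftop_ge (fun y => expR (u y))) => y; exact: expR_ge0.
Qed.

Lemma bounded_ucont_logop u : bounded_ucont u -> bounded_ucont (logop u).
Proof.
move=> hu; have [_ [m hm]] := hu.
have [h1 [B1 b1]] := bounded_ucont_shiftop (bounded_ucont_expR hu).
have lo x : expR (- m) <= shiftop (fun y => expR (u y)) x.
  apply: le_trans (shiftop_ge x (fun y => expR_ge0 (u y))).
  by rewrite ler_expR; have := hm x; rewrite ler_norml => /andP[].
split.
  apply: (@ucont_comp_lipschitz _ _ (@ln R) (expR (- m))^-1 _ h1).
    by rewrite invr_ge0 expR_ge0.
  move=> x y /=; rewrite [leRHS]mulrC.
  by apply: ln_sub_le => //; exact: expR_gt0.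
exists (Num.max m (ln B1)) => x; rewrite /logop ler_norml; apply/andP; split.
  rewrite lerNl; apply: (@le_trans _ _ m); last by rewrite le_max lexx.
  rewrite lerNl -[leLHS]expRK ler_ln ?posrE ?expR_gt0//.
  exact: shiftop_exp_gt0.
have := b1 x; rewrite ger0_norm ?(ltW (shiftop_exp_gt0 _ _))// => k.
rewrite le_max; apply/orP; right; rewrite ler_ln// ?posrE ?shiftop_exp_gt0//.
exact: lt_le_trans (shiftop_exp_gt0 _ _) k.
Qed.

(** [shiftop] is order preserving and positively homogeneous, so [logop] is order preserving and
    commutes with adding constants; nonexpansiveness in the sup norm follows. *)
Lemma logop_le_shift u v k x : bounded_ucont u -> bounded_ucont v ->
  (forall y, u y <= v y + k) -> logop u x <= logop v x + k.
Proof.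
move=> hu hv le.
have [/ucont_measurable m1 [B1 b1]] := bounded_ucont_expR hu.
have [/ucont_measurable m2 [B2 b2]] := bounded_ucont_expR hv.
have m3 : measurable_fun setT (fun y => expR k * expR (v y)) by exact: measurable_funM.
have b3 y : `|expR k * expR (v y)| <= expR k * B2.
  by rewrite normrM (ger0_norm (expR_ge0 k)) ler_wpM2l ?expR_ge0.
have p1 : 0 <= B1 := le_trans (normr_ge0 _) (b1 0).
have p2 : 0 <= expR k * B2 := le_trans (normr_ge0 _) (b3 0).
have le' y : expR (u y) <= expR k * expR (v y) by rewrite -expRD ler_expR addrC.
have G : shiftop (fun y => expR (u y)) x <= expR k * shiftop (fun y => expR (v y)) x.
  rewrite /shiftop mulrDr lerD//.
    rewrite -(@convop_scale _ x (expR k) B2 m2 b2).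
    apply: (@convop_le _ _ x (B1 + expR k * B2)) => // y.
      by have := b1 y; lra.
    by have := b3 y; lra.
  rewrite mulrCA ler_wpM2l//; have := ca1 x; lra.
have P := shiftop_exp_gt0 v x.
rewrite /logop -[k in leRHS]expRK -lnM ?posrE ?expR_gt0 //.
rewrite ler_ln ?posrE ?mulr_gt0 ?expR_gt0 ?shiftop_exp_gt0//.
by rewrite mulrC.
Qed.

Lemma logop_cst k x : logop (cst k) x = k + ln (\int[leb]_s N x s + (c - a x)).
Proof.
rewrite /logop /shiftop /convop /=.
have -> : \int[leb]_s (N x s * expR k) = expR k * \int[leb]_s N x s.
  by rewrite -int_scale//; apply: int_ext => s; rewrite mulrC.
rewrite [(c - a x) * _]mulrC -mulrDr lnM ?posrE ?expR_gt0 ?expRK//.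
have : 0 <= \int[leb]_s N x s by apply: int_ge0.
by have := ca1 x; lra.
Qed.

(* [(1 - e) * logop] is a contraction in the sup norm, started here from a constant subsolution.
   An approximate fixed point is enough, so no passage to the limit is needed. *)
Lemma discounted_solution (e g0 g1 : R) : 0 < e < 1 ->
  0 < g0 -> (forall x, g0 <= \int[leb]_s N x s + (c - a x)) ->
  (forall x, \int[leb]_s N x s + (c - a x) <= g1) ->
  exists u, [/\ bounded_ucont u, forall x, `|u x - (1 - e) * logop u x| <= e
    & forall x, (1 - e) * ln g0 <= e * u x <= (1 - e) * ln g1].
Proof.
move=> /andP[e0 e1] g00 hg0 hg1.
have g10 : 0 < g1 := lt_le_trans g00 (le_trans (hg0 0) (hg1 0)).
pose F u x := (1 - e) * logop u x.
(* The fixed points of [k |-> (1 - e) * (k + ln g)] for [g = g0] and [g = g1]: a constant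
   subsolution and a constant supersolution. *)
pose lo := (1 - e) / e * ln g0; pose hi := (1 - e) / e * ln g1.
have elo : e * lo = (1 - e) * ln g0 by rewrite /lo; field; rewrite gt_eqF.
have ehi : e * hi = (1 - e) * ln g1 by rewrite /hi; field; rewrite gt_eqF.
pose U := fix U n := if n is n'.+1 then F (U n') else cst lo.
have hF u : bounded_ucont u -> bounded_ucont (F u).
  move=> /bounded_ucont_logop[h1 [B h2]]; split.
    apply: (@ucont_comp_lipschitz _ _ ( *%R (1 - e)) (1 - e) _ h1); first lra.
    by move=> x y; rewrite -mulrBr normrM ger0_norm//; lra.
  exists ((1 - e) * B) => x; rewrite normrM ger0_norm; last lra.
  by rewrite ler_wpM2l//; lra.
have hU n : bounded_ucont (U n).
  by elim: n => [|n IH]; [exact: bounded_ucont_cst|exact: hF].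
have hlh : lo <= hi.
  apply: ler_wpM2l; first by rewrite divr_ge0//; lra.
  by rewrite ler_ln// (le_trans (hg0 0)).
have bU n x : lo <= U n x <= hi.
  elim: n x => [|n IH] x; first by rewrite lexx.
  have k1 : logop (cst lo) x <= logop (U n) x + 0.
    apply: logop_le_shift => //; first exact: bounded_ucont_cst.
    by move=> y; rewrite addr0; case/andP: (IH y).
  have k2 : logop (U n) x <= logop (cst hi) x + 0.
    apply: logop_le_shift => //; first exact: bounded_ucont_cst.
    by move=> y; rewrite addr0; case/andP: (IH y).
  rewrite !logop_cst in k1 k2.
  have q1 : ln g0 <= ln (\int[leb]_s N x s + (c - a x)).
    by rewrite ler_ln // posrE (lt_le_trans g00).
  have q2 : ln (\int[leb]_s N x s + (c - a x)) <= ln g1.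
    by rewrite ler_ln // posrE (lt_le_trans g00).
  rewrite /= /F; apply/andP; split.
    have : (1 - e) * (lo + ln g0) <= (1 - e) * logop (U n) x by apply: ler_wpM2l; lra.
    lra.
  have : (1 - e) * logop (U n) x <= (1 - e) * (hi + ln g1) by apply: ler_wpM2l; lra.
  lra.
have dU n x : `|U n.+1 x - U n x| <= (1 - e) ^+ n * (hi - lo).
  elim: n x => [|n IH] x.
    have /andP[l1 l2] := bU 1%N x; rewrite expr0 mul1r.
    by have -> : U 0%N x = lo by []; rewrite ger0_norm; lra.
  have k1 : logop (U n.+1) x <= logop (U n) x + (1 - e) ^+ n * (hi - lo).
    by apply: logop_le_shift => // y; have := IH y; rewrite ler_norml; lra.
  have k2 : logop (U n) x <= logop (U n.+1) x + (1 - e) ^+ n * (hi - lo).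
    by apply: logop_le_shift => // y; have := IH y; rewrite ler_norml; lra.
  have -> : U n.+2 x - U n.+1 x = (1 - e) * (logop (U n.+1) x - logop (U n) x).
    by rewrite /= /F; ring.
  rewrite exprS -mulrA normrM ger0_norm; last lra.
  rewrite ler_wpM2l//; first lra.
  by rewrite ler_norml; lra.
have [n hn] : exists n, (1 - e) ^+ n * (hi - lo) <= e.
  have : (fun n => (1 - e) ^+ n * (hi - lo)) @ \oo --> 0 * (hi - lo).
    apply: cvgMl; apply: cvg_expr; rewrite ger0_norm; lra.
  rewrite mul0r => /cvgrPdist_le/(_ e e0)[n _ hn]; exists n.
  have := hn n (leqnn n); rewrite /= sub0r normrN; apply: le_trans.
  exact: ler_norm.
exists (U n); split=> // x.
  by rewrite distrC; exact: le_trans (dU n x) hn.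
have /andP[h1 h2] := bU n x.
by rewrite -elo -ehi; apply/andP; split; rewrite ler_wpM2l//; lra.
Qed.

End discounted_problem.

(** * Chaining of local masses *)

Section chaining.
Context {R : realType}.
Variables (N : R -> R -> R) (theta Delta k P : R).
Hypotheses (N0 : forall x s, 0 <= N x s) (iN : forall x, ig (N x)).
Hypotheses (theta0 : 0 < theta) (Delta0 : 0 < Delta) (k0 : 0 <= k) (P0 : 0 <= P).
Hypotheses (Nlow : forall x s, `|s| <= Delta -> theta <= N x s).
Hypotheses (Nup : forall x s, N x s <= k * expR (P * `|s|)).
Variables (phi : R -> R) (C S : R).
Hypotheses (phi0 : forall x, 0 <= phi x) (phiS : forall x, phi x <= S).
Hypotheses (mphi : measurable_fun setT phi) (C0 : 0 <= C).
Hypothesis phiC : forall x, convop N phi x <= C * phi x.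
Implicit Types (x y z r : R).

Let phib y : `|phi y| <= S.
Proof. by rewrite ger0_norm. Qed.

Let S0 : 0 <= S := le_trans (phi0 0) (phiS 0).

(** The kernel sees only integrals of [phi], so the chain links window masses; pointwise values
    enter through [C * phi]. *)
Definition mass (x r : R) : R := \int[leb]_y (phi y * chi (x - r) (x + r) y).

Lemma integrable_window a b : ig (fun y => phi y * chi a b y).
Proof.
apply: (@integrable_dominated _ _ (fun y => S * chi a b y)).
- by apply: measurable_funM => //; exact: measurable_chi.
- move=> y; rewrite normrM (ger0_norm (chi_ge0 _ _ _)).
  by rewrite ler_wpM2r ?chi_ge0.
- by apply: integrable_scale; exact: integrable_chi.
Qed.

Let kernel_int x : ig (fun y => N x (x - y) * phi y).
Proof.
have := integrable_reflect x (integrable_convop iN x mphi phib).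
by under eq_fun do rewrite subKr.
Qed.

Lemma convop_centered x : convop N phi x = \int[leb]_y (N x (x - y) * phi y).
Proof.
rewrite /convop -(int_reflect x (kernel_int x)).
by apply: int_ext => s; rewrite subKr.
Qed.

Lemma mass_ge0 x r : 0 <= mass x r.
Proof. by apply: int_ge0 => y; rewrite mulr_ge0 ?chi_ge0. Qed.

Lemma mass_le x x' r r' : `|x - x'| + r <= r' -> mass x r <= mass x' r'.
Proof.
move=> h; apply: int_le; [exact: integrable_window..|] => y.
rewrite ler_wpM2l// /chi; case: ifP => [/andP[h1 h2]|_]; last by case: ifP.
have := ler_norm (x - x'); have := ler_norm (x' - x); rewrite distrC => h3 h4.
by rewrite ifT//; apply/andP; split; lra.
Qed.

Lemma mass_le_convop x : theta * mass x Delta <= convop N phi x.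
Proof.
rewrite convop_centered /mass -int_scale; last exact: integrable_window.
apply: int_le => //; first by apply: integrable_scale; exact: integrable_window.
move=> y; rewrite /chi; case: ifP => [/andP[h1 h2]|_].
  by rewrite mulr1 ler_wpM2r// Nlow// ler_norml; apply/andP; split; lra.
by rewrite !mulr0 mulr_ge0.
Qed.

(** A window of radius [h] whose centre is within [h] of a point lies within range [Delta] of that
    point, where the kernel is at least [theta]. *)
Let h : R := Delta / 2.
Let h0 : 0 < h. Proof. by rewrite divr_gt0. Qed.
Let hD : h + h = Delta. Proof. by rewrite /h -splitr. Qed.

Lemma phi_ge_mass x z : `|z - x| <= h -> theta * mass x h <= C * phi z.
Proof.
move=> xz; apply: (@le_trans _ _ (theta * mass z Delta)).
  by rewrite ler_wpM2l ?(ltW theta0)//; apply: mass_le; rewrite distrC -hD; lra.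
exact: le_trans (mass_le_convop z) (phiC z).
Qed.

(** [C / (theta * h)] is the cost of moving a window by [h]; the 3 pays for the three windows added
    up in [mass_wide]. *)
Let Q : R := 3 + C / (theta * h).
Let Q3 : 3 <= Q.
Proof. by rewrite /Q lerDl divr_ge0// ltW// mulr_gt0. Qed.

(** The pointwise bound [phi_ge_mass] is integrated over the overlap [[m1, m2]] of the two windows,
    whose length is at least [h]. *)
Lemma mass_step x x' : `|x - x'| <= h -> mass x h <= Q * mass x' h.
Proof.
move=> xx'; set m1 := Num.max x x' - h; set m2 := Num.min x x' + h.
have hh0 := h0.
have [a1 a2] : x <= x' + h /\ x' <= x + h.
  by move: xx'; rewrite ler_norml => /andP[? ?]; split; lra.
have m12 : h <= m2 - m1.
  rewrite /m1 /m2 /Num.max /Num.min; case: ifP => _; lra.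
have win y : chi m1 m2 y <= chi (x' - h) (x' + h) y.
  rewrite /chi; case: ifP => [/andP[b1 b2]|_]; last by case: ifP.
  rewrite ifT//; move: b1 b2; rewrite /m1 /m2 lerBlDr ge_max => /andP[c1 c2].
  by rewrite -lerBlDr le_min => /andP[c3 c4]; apply/andP; split; lra.
have key : theta * mass x h * h <= C * mass x' h.
  apply: (@le_trans _ _ (theta * mass x h * (m2 - m1))).
    by rewrite ler_wpM2l// mulr_ge0 ?mass_ge0// ltW.
  rewrite -(@int_chi _ m1 m2); last lra.
  rewrite -int_scale; last exact: integrable_chi.
  rewrite /(mass x') -int_scale; last exact: integrable_window.
  apply: int_le.
  - by apply: integrable_scale; exact: integrable_chi.
  - by apply: integrable_scale; exact: integrable_window.
  move=> y; apply: (@le_trans _ _ (C * phi y * chi m1 m2 y)); last first.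
    by rewrite mulrA ler_wpM2l ?mulr_ge0.
  rewrite /chi; case: ifP => [/andP[b1 b2]|_]; last by rewrite !mulr0.
  rewrite !mulr1; apply: phi_ge_mass; rewrite ler_norml.
  move: b1 b2; rewrite /m1 /m2 lerBlDr ge_max => /andP[c1 c2].
  by rewrite -lerBlDr le_min => /andP[c3 c4]; apply/andP; split; lra.
have th0 : 0 < theta * h by rewrite mulr_gt0.
apply: (@le_trans _ _ (C / (theta * h) * mass x' h)).
  by rewrite mulrAC ler_pdivlMr// mulrA [_ * theta]mulrC.
by rewrite ler_wpM2r ?mass_ge0// /Q lerDr.
Qed.

Lemma mass_chain n x x' : `|x - x'| <= n%:R * h -> mass x h <= Q ^+ n * mass x' h.
Proof.
have hh0 := h0; have Q0 : 0 <= Q by have := Q3; lra.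
elim: n x x' => [|n IH] x x'.
  by rewrite mul0r normr_le0 subr_eq0 => /eqP ->; rewrite expr0 mul1r.
move=> xx'; pose t : R := n%:R / n.+1%:R.
have t0 : 0 <= t by rewrite divr_ge0.
have n1 : (0 : R) < n.+1%:R by [].
have n1E : (n.+1%:R : R) = n%:R + 1 by rewrite -natr1.
have t1 : 1 - t = n.+1%:R^-1 by rewrite /t n1E; field; rewrite -n1E gt_eqF.
(* [z] divides the segment so that [n] steps lead from [x] to [z] and one from [z] to [x']. *)
pose z := x + t * (x' - x).
have k1 : `|x - z| <= n%:R * h.
  have -> : x - z = t * (x - x') by rewrite /z; ring.
  rewrite normrM ger0_norm// /t mulrAC ler_pdivrMr// -mulrA ler_wpM2l//.
  by rewrite mulrC.
have k2 : `|z - x'| <= h.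
  have -> : z - x' = n.+1%:R^-1 * (x - x') by rewrite -t1 /z; ring.
  by rewrite normrM ger0_norm ?invr_ge0// mulrC ler_pdivrMr// mulrC.
apply: (le_trans (IH _ _ k1)); rewrite exprSr -mulrA.
by rewrite ler_wpM2l ?exprn_ge0//; exact: mass_step.
Qed.

Lemma mass_wide n x : mass x (n%:R * h) <= Q ^+ n * mass x h.
Proof.
have hh0 := h0; have q3 := Q3; have Q0 : 0 <= Q by lra.
elim: n => [|n IH].
  by rewrite expr0 mul1r mul0r; apply: mass_le; rewrite subrr normr0 addr0 ltW.
have n0 : 0 <= n%:R * h by rewrite mulr_ge0 // ltW.
have near_ z : `|x - z| <= n%:R * h -> mass z h <= Q ^+ n * mass x h.
  by rewrite distrC; exact: mass_chain.
have kl : mass (x - n%:R * h) h <= Q ^+ n * mass x h.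
  by apply: near_; rewrite subKr ger0_norm.
have kr : mass (x + n%:R * h) h <= Q ^+ n * mass x h.
  by apply: near_; rewrite opprD addNKr normrN ger0_norm.
(* Enlarging the radius by [h] only adds two windows of radius [h], centred at the old endpoints. *)
have sp : mass x (n.+1%:R * h) <= mass x (n%:R * h) +
   (mass (x - n%:R * h) h + mass (x + n%:R * h) h).
  have w a b := integrable_window a b.
  have iw2 := integrable_add (w (x - n%:R * h - h) (x - n%:R * h + h))
    (w (x + n%:R * h - h) (x + n%:R * h + h)).
  have iw3 := integrable_add (w (x - n%:R * h) (x + n%:R * h)) iw2.
  rewrite /mass -int_add; try exact: w.
  rewrite -int_add//; apply: int_le => //.
    move=> y; rewrite -!mulrDr ler_wpM2l// -natr1 mulrDl mul1r.
    have e1 := chi_ge0 (x - n%:R * h) (x + n%:R * h) y.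
    have e2 := chi_ge0 (x - n%:R * h - h) (x - n%:R * h + h) y.
    have e3 := chi_ge0 (x + n%:R * h - h) (x + n%:R * h + h) y.
    rewrite {1}/chi; case: ifP => [/andP[b1 b2]|_]; last by lra.
    have [c1|c1] := ltP y (x - n%:R * h).
      have -> : chi (x - n%:R * h - h) (x - n%:R * h + h) y = 1; last lra.
      by rewrite /chi ifT//; apply/andP; split; lra.
    have [c2|c2] := leP y (x + n%:R * h).
      have -> : chi (x - n%:R * h) (x + n%:R * h) y = 1; last lra.
      by rewrite /chi ifT//; apply/andP; split; lra.
    have -> : chi (x + n%:R * h - h) (x + n%:R * h + h) y = 1; last lra.
    by rewrite /chi ifT//; apply/andP; split; lra.
have : 3 * (Q ^+ n * mass x h) <= Q ^+ n.+1 * mass x h.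
  by rewrite exprS -mulrA ler_wpM2r// mulr_ge0 ?mass_ge0 ?exprn_ge0.
lra.
Qed.

Lemma integrable_tail x r : ig (fun s => N x s * (1 - chi (- r) r s)).
Proof.
apply: (@integrable_mulb _ _ _ 1) => //.
  by apply: measurable_funB => //; exact: measurable_chi.
move=> s; have := chi_ge0 (- r) r s; have := chi_le1 (- r) r s.
by move=> ? ?; rewrite ler_norml; apply/andP; split; lra.
Qed.

(** Within range [r] the kernel is at most [k * expR (P * r)]; beyond it only the tail mass and the
    global bound [S] are available. *)
Lemma convop_le_mass x r :
  convop N phi x <= k * expR (P * r) * mass x r
                    + \int[leb]_s (N x s * (1 - chi (- r) r s)) * S.
Proof.
rewrite convop_centered.
have it := integrable_reflect x (integrable_tail x r).
rewrite -(int_reflect x (integrable_tail x r)) [_ * S]mulrC.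
have iw := integrable_window (x - r) (x + r).
rewrite /mass -!int_scale// -int_add; try exact: integrable_scale.
apply: int_le => //; first by apply: integrable_add; exact: integrable_scale.
move=> y; have -> : chi (- r) r (x - y) = chi (x - r) (x + r) y.
  rewrite /chi; congr (if _ then _ else _).
  by apply/andP/andP => -[h1 h2]; split; lra.
rewrite /chi; case: ifP => [/andP[h1 h2]|_].
  rewrite subrr !mulr0 addr0 mulr1 ler_wpM2r//.
  apply: (le_trans (Nup _ _)); rewrite ler_wpM2l// ler_expR ler_wpM2l//.
  by rewrite ler_norml; apply/andP; split; lra.
by rewrite !mulr0 add0r subr0 mulr1 mulrC ler_wpM2r.
Qed.

(** [n] counts the steps that widen the window to the cut-off radius, [m] those from [x] to [x'].
    The tail term [Z * S] is either balanced by a large decay rate or zero for compact support. *)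
Lemma convop_compare x x' n m Z : `|x - x'| <= m%:R * h ->
  \int[leb]_s (N x s * (1 - chi (- (n%:R * h)) (n%:R * h) s)) <= Z ->
  convop N phi x <= k / theta * (expR (P * (n%:R * h)) * Q ^+ (n + m)) * convop N phi x'
     + Z * S.
Proof.
move=> xx' tail; have hh0 := h0; have Q0 : 0 <= Q by have := Q3; lra.
have n0 : 0 <= n%:R * h by rewrite mulr_ge0 // ltW.
apply: (le_trans (convop_le_mass x (n%:R * h))); apply: lerD; last first.
  by rewrite ler_wpM2r.
have j1 : mass x (n%:R * h) <= Q ^+ (n + m) * mass x' h.
  apply: (le_trans (mass_wide n x)); rewrite exprD -mulrA.
  by rewrite ler_wpM2l ?exprn_ge0 ?mass_chain.
have j2 : mass x' h <= convop N phi x' / theta.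
  rewrite ler_pdivlMr// mulrC; apply: le_trans (mass_le_convop x').
  by rewrite ler_wpM2l ?(ltW theta0)//; apply: mass_le; rewrite subrr normr0 -hD; lra.
have e0 := expR_ge0 (P * (n%:R * h)).
apply: (@le_trans _ _ (k * expR (P * (n%:R * h)) * (Q ^+ (n + m) * (convop N phi x' / theta)))).
  rewrite ler_wpM2l ?mulr_ge0//; apply: (le_trans j1).
  by rewrite ler_wpM2l ?exprn_ge0.
by rewrite le_eqVlt; apply/orP; left; apply/eqP; field; rewrite gt_eqF.
Qed.

End chaining.

(** * Weak Harnack inequality for discounted solutions *)

Section weak_harnack.
Context {R : realType}.
Variables (N : R -> R -> R) (a : R -> R) (c M : R) (theta Delta k P b0 b1 : R).
Hypotheses (N0 : forall x s, 0 <= N x s) (iN : forall x, ig (N x)).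
Hypotheses (theta0 : 0 < theta) (Delta0 : 0 < Delta) (k0 : 0 <= k) (P0 : 0 <= P).
Hypotheses (Nlow : forall x s, `|s| <= Delta -> theta <= N x s).
Hypotheses (Nup : forall x s, N x s <= k * expR (P * `|s|)).
Hypothesis Ntail : forall q, exists Mq, forall x r, 0 <= r ->
  \int[leb]_s (N x s * (1 - chi (- r) r s)) <= Mq * expR (- (q * r)).
Hypotheses (auc : ucont a) (ca1 : forall x, 1 <= c - a x).
Hypotheses (b00 : 0 <= b0) (b01 : b0 <= b1).
Implicit Types (u : R -> R) (e x y : R).

(** Approximate solutions with residual [e]. The a priori bounds are stated for [e * u], the
    quantity that stays bounded as [e] tends to 0. *)
Definition dsol e u := [/\ bounded_ucont u,
  forall x, `|u x - (1 - e) * logop N a c u x| <= e &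
  forall x, (1 - e) * b0 <= e * u x <= (1 - e) * b1].

Local Notation ex u := (fun y => expR (u y)).

(** With [w] the value of [logop], [u = (1 - e) * w + O(e)] gives [w - u = e * w + O(e)], and the
    bounds on [e * u] carry over to [e * w]. *)
Lemma logop_sub_bounds e u x : 0 < e <= 2^-1 -> dsol e u ->
  b0 - 2 * e <= logop N a c u x - u x <= b1 + 1.
Proof.
move=> /andP[e0 e2] [_ hu hb]; set w := logop N a c u x.
have e1 : 0 < 1 - e by lra.
have := hu x; rewrite ler_norml -/w => /andP[h1 h2].
have /andP[h3 h4] := hb x.
have U : e * w <= b1 + e.
  rewrite -(ler_pM2l e1) mulrCA.
  have : e * ((1 - e) * w) <= e * (u x + e) by rewrite ler_pM2l//; lra.
  have : e * e <= (1 - e) * e by rewrite ler_pM2r//; lra.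
  lra.
have L : b0 - e <= e * w.
  rewrite -(ler_pM2l e1) [leRHS]mulrCA.
  have : e * (u x - e) <= e * ((1 - e) * w) by rewrite ler_pM2l//; lra.
  have : e * e <= (1 - e) * e by rewrite ler_pM2r//; lra.
  lra.
apply/andP; split; lra.
Qed.

Lemma expR_logop u x : expR (logop N a c u x) = shiftop N a c (ex u) x.
Proof. by rewrite /logop lnK// posrE; exact: shiftop_exp_gt0. Qed.

Lemma convop_logop u x :
  convop N (ex u) x = (expR (logop N a c u x - u x) - (c - a x)) * expR (u x).
Proof.
rewrite mulrBl -expRD subrK expR_logop /shiftop; ring.
Qed.

Let C : R := expR (b1 + 1).

Lemma convop_le_dsol e u x : 0 < e <= 2^-1 -> dsol e u ->
  convop N (ex u) x <= C * expR (u x).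
Proof.
move=> he hu; rewrite convop_logop ler_wpM2r ?expR_ge0//.
have /andP[_ h] := logop_sub_bounds x he hu.
have : expR (logop N a c u x - u x) <= C by rewrite ler_expR.
have := ca1 x; lra.
Qed.

Let int_chiD (d : R) : 0 <= d -> \int[leb]_s chi (- d) d s = 2 * d.
Proof. by move=> d0; rewrite int_chi; lra. Qed.

Lemma dsol_ge0 e u x : 0 < e <= 2^-1 -> dsol e u -> 0 <= u x.
Proof.
move=> /andP[e0 e2] [_ _ /(_ x)/andP[h _]].
have e1 : 0 <= 1 - e by lra.
by rewrite -(pmulr_rge0 _ e0) (le_trans _ h)// mulr_ge0.
Qed.

Lemma dsol_measurable e u : dsol e u -> measurable_fun setT (ex u).
Proof. by case=> /bounded_ucont_expR[/ucont_measurable]. Qed.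

Lemma dsol_bound e u x : 0 < e <= 2^-1 -> dsol e u -> expR (u x) <= expR (b1 / e).
Proof.
move=> /andP[e0 e2] [_ _ /(_ x)/andP[_ h]].
rewrite ler_expR ler_pdivlMr// mulrC; apply: (le_trans h).
have : 0 <= e * b1 by rewrite mulr_ge0 ?(ltW e0)// (le_trans b00).
lra.
Qed.

Lemma dsol_bound_norm e u x : 0 < e <= 2^-1 -> dsol e u -> `|expR (u x)| <= expR (b1 / e).
Proof. by move=> he hu; rewrite ger0_norm ?expR_ge0// dsol_bound. Qed.

Lemma convop_ge_local e u x d m : 0 < e <= 2^-1 -> dsol e u -> 0 <= d <= Delta -> 0 <= m ->
  (forall y, `|x - y| <= d -> m <= expR (u y)) -> theta * m * (2 * d) <= convop N (ex u) x.
Proof.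
move=> he hu /andP[d0 dD] m0 hm; rewrite -(int_chiD d0) -int_scale; last exact: integrable_chi.
apply: int_le.
- by apply: integrable_scale; exact: integrable_chi.
- apply: (integrable_convop iN x (dsol_measurable hu)) => y.
  exact: dsol_bound_norm he hu.
move=> s; rewrite /chi; case: ifP => [/andP[h1 h2]|_]; last first.
  by rewrite mulr0 mulr_ge0 ?expR_ge0.
have sd : `|s| <= d by rewrite ler_norml h1.
rewrite mulr1; apply: ler_pM => //; first exact: ltW.
- by apply: Nlow; exact: le_trans dD.
- by apply: hm; rewrite subKr.
Qed.

(** [expR (s / e)] outgrows any constant, so factors independent of [e] can be absorbed in such a
    loss. *)
Lemma expR_absorb (K s e1 : R) : 0 < s -> 0 < e1 -> exists2 e2, 0 < e2 <= e1 &
  forall e, 0 < e <= e2 -> K <= expR (s / e).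
Proof.
move=> s0 e10; have K1 : 0 < `|K| + 1 by have := normr_ge0 K; lra.
exists (Num.min e1 (s / (`|K| + 1))).
  by rewrite lt_min e10 divr_gt0//= ge_min lexx.
move=> e /andP[e0]; rewrite le_min => /andP[_ he].
apply: le_trans (expR_ge1Dx (s / e)).
rewrite ler_pdivlMr// mulrC -ler_pdivlMr// in he.
have := ler_norm K; lra.
Qed.

(* With [e = rho / n], chaining over [n] steps costs [exp (s / (2 e))], while the kernel tail beyond
   distance [n * h], taken with a large enough rate [q], cancels the crude bound
   [exp (b1 / e)] on the solution. *)
Lemma convop_slow_variation (l s e1 : R) : 0 < l -> 0 < s -> 0 < e1 ->
  exists2 e, 0 < e <= e1 & forall u, dsol e u -> forall x x', `|x - x'| <= l ->
  convop N (ex u) x <= expR (s / e) * convop N (ex u) x'.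
Proof.
move=> l0 s0 e10.
pose h : R := Delta / 2; have h0 : 0 < h by rewrite divr_gt0.
pose Q : R := 3 + C / (theta * h).
have C0 : 0 <= C by exact: expR_ge0.
have Q3 : 3 <= Q by rewrite /Q lerDl divr_ge0// ltW// mulr_gt0.
(* Logarithmic cost of one step of length [h]: growth of the kernel bound plus the factor [Q]. *)
pose bet := P * h + ln Q.
have bet0 : 0 < bet.
  have : 0 < ln Q by apply: ln_gt0; lra.
  by apply: ltr_wpDl; rewrite mulr_ge0// ltW.
pose rho := s / 2 / bet; have rho0 : 0 < rho by rewrite !divr_gt0.
(* With this rate the decay at distance [n * h = rho * h / e] is exactly [expR (- (b1 / e))]. *)
have [Mq hMq] := Ntail (b1 / (rho * h)).
pose m := (Num.truncn (l / h)).+1.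
have ml : l <= m%:R * h by rewrite -ler_pdivrMr// ltW// truncnS_gt.
(* As [u >= 0], [g] bounds [convop N (expR u)] from below, which turns the additive constant [Mq]
   left by the tail into a multiple of [convop]. *)
pose g := theta * 1 * (2 * Delta); have g0 : 0 < g by rewrite !mulr_gt0.
pose K := k / theta * Q ^+ m + `|Mq| / g.
have e12 : 0 < Num.min e1 2^-1 by rewrite lt_min e10 invr_gt0/=.
have s20 : 0 < s / 2 by rewrite divr_gt0.
have [e2 /andP[e20 e21] he2] := expR_absorb K s20 e12.
pose n := (Num.truncn (rho / e2)).+1; pose e := rho / n%:R.
have n0 : (0 : R) < n%:R by [].
have e0 : 0 < e by rewrite divr_gt0.
have ee2 : e <= e2.
  by rewrite ler_pdivrMr// mulrC -ler_pdivrMr// ltW// truncnS_gt.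
move: e21; rewrite le_min => /andP[e21 e22].
exists e; first by rewrite e0 (le_trans ee2).
move=> u hu x x' xx'.
have he : 0 < e <= 2^-1 by rewrite e0 (le_trans ee2).
have nE : n%:R = rho / e by rewrite /e invf_div mulrCA divff ?mulr1// gt_eqF.
have mT y : convop N (ex u) y <= C * expR (u y) by exact: convop_le_dsol hu.
have gT : g <= convop N (ex u) x'.
  apply: (convop_ge_local he hu) => //; first by rewrite lexx ltW.
  by move=> y _; rewrite -expR0 ler_expR (dsol_ge0 _ he hu).
have := @convop_compare R N theta Delta k P N0 iN theta0 Delta0 k0 P0 Nlow Nup (ex u) C
  (expR (b1 / e)) (fun y => expR_ge0 _) (fun y => dsol_bound y he hu) (dsol_measurable hu)
  C0 mT x x' n m _ (le_trans xx' ml) (hMq x _ (mulr_ge0 (ler0n _ _) (ltW h0))).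
rewrite -/h -/Q => H; apply: (le_trans H).
have -> : Mq * expR (- (b1 / (rho * h) * (n%:R * h))) * expR (b1 / e) = Mq.
  rewrite -mulrA -expRD nE.
  have -> : - (b1 / (rho * h) * (rho / e * h)) + b1 / e = 0.
    by field; rewrite !gt_eqF.
  by rewrite expR0 mulr1.
have -> : expR (P * (n%:R * h)) * Q ^+ (n + m) = expR (s / 2 / e) * Q ^+ m.
  rewrite exprD mulrA; congr (_ * _).
  have Qpos : Q \is Num.pos by rewrite posrE (lt_le_trans _ Q3).
  rewrite -[Q in Q ^+ _](lnK Qpos).
  rewrite -expRM_natl -expRD; congr expR.
  rewrite mulrCA -mulrDr -/bet nE /rho; field.
  by rewrite (gt_eqF bet0) (gt_eqF e0).
have E1 : 1 <= expR (s / 2 / e) by apply: le_trans (expR_ge1Dx _); rewrite lerDl divr_ge0// ltW.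
have Tx0 : 0 <= convop N (ex u) x' by apply: ltW; exact: lt_le_trans gT.
have A1 : Mq <= `|Mq| / g * convop N (ex u) x'.
  apply: (le_trans (ler_norm _)); rewrite mulrAC ler_pdivlMr// ler_wpM2l//.
have A2 : `|Mq| / g * convop N (ex u) x' <= expR (s / 2 / e) * (`|Mq| / g * convop N (ex u) x').
  by rewrite ler_peMl// mulr_ge0// divr_ge0// ltW.
have A3 : K <= expR (s / 2 / e) by apply: he2; rewrite e0.
have -> : s / e = s / 2 / e + s / 2 / e by field; rewrite gt_eqF.
rewrite expRD.
have A4 : expR (s / 2 / e) * (K * convop N (ex u) x') <=
  expR (s / 2 / e) * (expR (s / 2 / e) * convop N (ex u) x').
  by rewrite ler_wpM2l ?expR_ge0// ler_wpM2r.
rewrite -[leRHS]mulrA; apply: le_trans A4; rewrite /K mulrDl mulrDr.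
apply: lerD; last exact: le_trans A1 A2.
by rewrite le_eqVlt; apply/orP; left; apply/eqP; ring.
Qed.

(* By uniform continuity of [a], [u] cannot drop fast at small scale, so [convop phi] is at least
   [exp (- 3 z / e)] times [phi]; [convop_slow_variation] transports this to distance [l]. *)
Lemma weak_harnack (l s e1 : R) : 0 < l -> 0 < s -> 0 < e1 ->
  exists2 e, 0 < e <= e1 & forall u, dsol e u -> forall x x', `|x - x'| <= l ->
  e * (u x - u x') <= s.
Proof.
(* Of the five parts, three cover the local drop [loc], one the transport of [convop], one the
   absorption of [K]. *)
move=> l0 s0 e10; pose z := s / 5; have z0 : 0 < z by rewrite divr_gt0.
have [d1 d10 hd1] := auc z0.
pose d := Num.min (d1 / 2) Delta.
have d0 : 0 < d by rewrite lt_min Delta0 divr_gt0.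
have dD : d <= Delta by rewrite ge_min lexx orbT.
have dd1 : d < d1.
  apply: (@le_lt_trans _ _ (d1 / 2)); first by rewrite ge_min lexx.
  lra.
pose K := C / (theta * (2 * d)).
have p0 : 0 < Num.min e1 (Num.min 2^-1 (z / 2)).
  by rewrite !lt_min e10 divr_gt0//= invr_gt0 ltr0Sn.
have [e2 /andP[e20 e21] hK] := expR_absorb K z0 p0.
have [e /andP[e0 ee2] he] := convop_slow_variation (ltr_wpDr (ltW d0) l0) z0 e20.
move: e21; rewrite !le_min => /and3P[e21 e22 e23].
exists e; first by rewrite e0 (le_trans ee2).
move=> u hu.
have eh : 0 < e <= 2^-1 by rewrite e0 (le_trans ee2).
have ez : e <= z / 2 by apply: le_trans e23.
have loc x x' : `|x - x'| <= d -> e * (u x - u x') <= 3 * z.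
  (* If the drop exceeds the loss [z / e] of [convop], both terms of [shiftop] grow by a factor at
     most [expR (u x - u x' + z)]. The discount [1 - e] then leaves [e * (u x - u x')] bounded by
     [z] plus residuals. *)
  move=> xx'; have [mz|zm] := leP (u x - u x') (z / e).
    by rewrite ler_pdivlMr// in mz; rewrite mulrC; lra.
  have [_ hs _] := hu.
  have a1 : c - a x <= expR z * (c - a x').
    have := hd1 _ _ (le_lt_trans xx' dd1); rewrite ler_norml => /andP[q1 q2].
    have : (1 + z) * (c - a x') <= expR z * (c - a x').
      by rewrite ler_wpM2r ?expR_ge1Dx//; have := ca1 x'; lra.
    have : z * 1 <= z * (c - a x') by rewrite ler_wpM2l// ltW.
    lra.
  have G : shiftop N a c (ex u) x <= expR (u x - u x' + z) * shiftop N a c (ex u) x'.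
    rewrite /shiftop mulrDr; apply: lerD.
      apply: (le_trans (he u hu x x' _)); first lra.
      apply: ler_wpM2r; first by apply: convop_ge0 => // y; exact: expR_ge0.
      by rewrite ler_expR; lra.
    rewrite [u x - u x' + z]addrC expRD -mulrA [expR (u x - u x') * _]mulrCA.
    rewrite -expRD subrK mulrA ler_wpM2r ?expR_ge0//.
  have W : logop N a c u x <= u x - u x' + z + logop N a c u x'.
    by rewrite -ler_expR expRD !expR_logop.
  have := hs x; have := hs x'; rewrite !ler_norml => /andP[q1 q2] /andP[q3 q4].
  have : (1 - e) * logop N a c u x <= (1 - e) * (u x - u x' + z + logop N a c u x').
    by rewrite ler_wpM2l//; lra.
  have : 0 <= e * z by rewrite mulr_ge0// ltW.
  lra.
move=> x x' xx'.
have t1 : theta * (expR (u x) / expR (3 * z / e)) * (2 * d) <= convop N (ex u) x.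
  apply: (convop_ge_local eh hu); first by rewrite (ltW d0).
    by rewrite divr_ge0 ?expR_ge0.
  move=> y xy; rewrite ler_pdivrMr ?expR_gt0// -expRD ler_expR.
  have := loc _ _ xy; rewrite mulrC -ler_pdivlMr//; lra.
have t2 : convop N (ex u) x <= expR (z / e) * convop N (ex u) x' by apply: he => //; lra.
have t3 := convop_le_dsol x' eh hu.
have D0 : 0 < theta * (2 * d) by rewrite !mulr_gt0.
have t4 : expR (u x) <= expR (3 * z / e) * (expR (z / e) * (K * expR (u x'))).
  rewrite -ler_pdivrMl ?expR_gt0//.
  have -> : expR (z / e) * (K * expR (u x')) =
      expR (z / e) * (C * expR (u x')) / (theta * (2 * d)) by rewrite /K; ring.
  rewrite ler_pdivlMr//; apply: (@le_trans _ _ (convop N (ex u) x)).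
    by apply: le_trans t1; rewrite le_eqVlt; apply/orP; left; apply/eqP; ring.
  by apply: (le_trans t2); rewrite ler_wpM2l ?expR_ge0.
have t5 : K <= expR (z / e) by apply: hK; rewrite e0.
have t6 : expR (u x) <= expR (5 * z / e + u x').
  apply: (le_trans t4).
  have -> : 5 * z / e + u x' = 3 * z / e + (z / e + (z / e + u x')) by field; rewrite gt_eqF.
  by rewrite 3!expRD !(ler_wpM2l, ler_wpM2r) ?expR_ge0.
rewrite ler_expR in t6; rewrite mulrC -ler_pdivlMr//.
have -> : s / e = 5 * z / e by rewrite /z; field; rewrite gt_eqF.
by rewrite lerBlDr.
Qed.

End weak_harnack.

(** * From almost periods to approximate eigenfunctions *)

Section almost_periodicity.
Context {R : realType}.
Variables (N : R -> R -> R) (a : R -> R) (c M A : R) (theta Delta k P g0 g1 : R).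
Hypotheses (N0 : forall x s, 0 <= N x s) (iN : forall x, ig (N x)).
Hypotheses (NM : forall x, \int[leb]_s N x s <= M).
Hypotheses (Nuc : forall e : R, 0 < e -> exists2 d : R, 0 < d &
  forall x y, `|x - y| < d -> \int[leb]_s `|N x s - N y s| <= e).
Hypotheses (theta0 : 0 < theta) (Delta0 : 0 < Delta) (k0 : 0 <= k) (P0 : 0 <= P).
Hypotheses (Nlow : forall x s, `|s| <= Delta -> theta <= N x s).
Hypotheses (Nup : forall x s, N x s <= k * expR (P * `|s|)).
Hypothesis Ntail : forall q, exists Mq, forall x r, 0 <= r ->
  \int[leb]_s (N x s * (1 - chi (- r) r s)) <= Mq * expR (- (q * r)).
Hypotheses (auc : ucont a) (ca1 : forall x, 1 <= c - a x) (caA : forall x, c - a x <= A).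
Hypotheses (g01 : 1 <= g0) (hg0 : forall x, g0 <= \int[leb]_s N x s + (c - a x)).
Hypothesis hg1 : forall x, \int[leb]_s N x s + (c - a x) <= g1.
Hypothesis net : forall d : R, 0 < d -> exists ts : seq R, forall x, exists2 t, t \in ts &
  forall z, `|a (z + x) - a (z + t)| <= d /\
    \int[leb]_s `|N (z + x) s - N (z + t) s| <= d.
Variables (CH eH : R).
Hypotheses (CH0 : 0 <= CH) (eH0 : 0 < eH).
Hypothesis translation_error : forall e u, 0 < e <= eH ->
  dsol N a c (ln g0) (ln g1) e u -> forall x t d,
  \int[leb]_s `|N x s - N t s| <= d ->
  \int[leb]_s (`|N x s - N t s| * expR (u (x - s))) <= CH * d * expR (u x).
Implicit Types (u : R -> R) (e x y z : R).

Local Notation ex u := (fun y => expR (u y)).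
Local Notation sol := (dsol N a c (ln g0) (ln g1)).

Let lng0 : 0 <= ln g0. Proof. exact: ln_ge0. Qed.
Let g01' : g0 <= g1. Proof. exact: le_trans (hg0 0) (hg1 0). Qed.
Let lng01 : ln g0 <= ln g1.
Proof. by rewrite ler_ln// posrE; apply: lt_le_trans ltr01 _ => //; exact: le_trans g01'. Qed.

(** The hypothesis is applied to the finite supremum of [f], which need not be attained. *)
Lemma contraction_bound (f : R -> R) e b : 0 < e <= 1 ->
  (exists K, forall y, f y <= K) ->
  (forall K, (forall y, f y <= K) -> forall y, f y <= (1 - e) * K + b) ->
  forall y, e * f y <= b.
Proof.
move=> /andP[e0 e1] [K0 hK0] h y; pose K := sup (range f).
have hs : has_sup (range f) by split; [exists (f 0); exists 0|exists K0 => _ [x _ <-]].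
have hK x : f x <= K by apply: ub_le_sup; [exact: hs.2|exists x].
have : K <= (1 - e) * K + b.
  by apply: ge_sup; [exact: hs.1|move=> _ [x _ <-]; exact: h].
have : e * f y <= e * K by rewrite ler_pM2l.
lra.
Qed.

Lemma bounded_ucont_shift u (r : R) : bounded_ucont u -> bounded_ucont (fun y => u (y + r)).
Proof.
move=> [hu [B hB]]; split; last by exists B.
move=> e /hu[d d0 hd]; exists d => // x y xy; apply: hd.
by have -> : x + r - (y + r) = x - y by ring.
Qed.

(** Both arguments of the logarithm are at least [expR (u x)] and differ by at most
    [(CH + 1) * d * expR (u x)], so the error does not depend on the size of [u]. *)
Lemma logop_translate e u x t d : 0 < e <= Num.min eH 2^-1 -> sol e u -> 
  `|a x - a t| <= d -> \int[leb]_s `|N x s - N t s| <= d ->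
  `|logop N a c (fun y => u (y + (x - t))) t - logop N a c u x| <= (CH + 1) * d.
Proof.
move=> /andP[e0]; rewrite le_min => /andP[eeH e2] hu had hNd.
have eh : 0 < e <= 2^-1 by rewrite e0.
have mu := dsol_measurable hu; have bu y := dsol_bound_norm lng0 lng01 y eh hu.
have [bu0 _ _] := hu.
have [/ucont_measurable mt [Bt bt]] := bounded_ucont_expR (bounded_ucont_shift (x - t) bu0).
pose f s := N t s * expR (u (x - s)).
have fE : (fun s => N t s * expR (u (t - s + (x - t)))) = f.
  by apply/funext => s; rewrite /f; congr (_ * expR (u _)); ring.
have i1 : ig f by rewrite -fE; exact: (integrable_convop iN t mt bt).
have i2 := integrable_convop iN x mu bu.
have errE : (fun s => `|N x s - N t s| * expR (u (x - s))) =
    (fun s => `|N x s * expR (u (x - s)) - f s|).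
  by apply/funext => s; rewrite /f -mulrBl normrM (ger0_norm (expR_ge0 _)).
have err : `|convop N (ex u) x - \int[leb]_s f s| <= CH * d * expR (u x).
  rewrite /convop -int_sub//; apply: le_trans (@translation_error e u _ hu x t d hNd); last first.
    by rewrite e0.
  rewrite errE; apply: norm_int_le => //; first exact: (integrableB _ i2 i1).
  exact: integrable_norm_sub.
have E : shiftop N a c (fun y => expR (u (y + (x - t)))) t =
   \int[leb]_s f s + (c - a t) * expR (u x).
  by rewrite /shiftop /convop -fE; congr (_ + _ * expR (u _)); ring.
rewrite /logop; apply: (@le_trans _ _ (((CH + 1) * d * expR (u x)) / expR (u x))); last first.
  by rewrite mulfK// gt_eqF ?expR_gt0.
apply: (le_trans (@ln_sub_le _ _ _ (expR (u x)) _ _ _)).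
- exact: expR_gt0.
- have := @shiftop_ge R N a c N0 ca1 (fun y => expR (u (y + (x - t)))) t (fun y => expR_ge0 _).
  by rewrite subrKC.
- exact: (@shiftop_ge R N a c N0 ca1 (ex u) x (fun y => expR_ge0 _)).
rewrite ler_wpM2r ?invr_ge0 ?expR_ge0// E /shiftop.
have -> : \int[leb]_s f s + (c - a t) * expR (u x) -
    (convop N (ex u) x + (c - a x) * expR (u x)) =
  (a x - a t) * expR (u x) - (convop N (ex u) x - \int[leb]_s f s) by ring.
apply: (le_trans (ler_normB _ _)); rewrite normrM (ger0_norm (expR_ge0 _)).
have : `|a x - a t| * expR (u x) <= d * expR (u x) by rewrite ler_wpM2r ?expR_ge0.
lra.
Qed.

(** The translate of [u] by [x - t] nearly solves the same equation. Since [(1 - e) * logop]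
    contracts with factor [1 - e], the difference is at most the defects divided by [e]. *)
Lemma dsol_translate e u x t d : 0 < e <= Num.min eH 2^-1 -> sol e u ->
  (forall z, `|a (z + x) - a (z + t)| <= d /\
    \int[leb]_s `|N (z + x) s - N (z + t) s| <= d) ->
  e * `|u x - u t| <= 2 * e + (CH + 1) * d.
Proof.
move=> he hu hz; have [e0 e1] : 0 < e /\ e < 1.
  by move: he; rewrite le_min => /andP[? /andP[_ ?]]; split => //; lra.
have [bu hs hb] := hu; have bt := bounded_ucont_shift (x - t) bu.
set v := fun y => u (y + (x - t)) in bt.
have d0 : 0 <= (CH + 1) * d.
  by rewrite mulr_ge0// ?(le_trans _ (hz 0).1)// addr_ge0.
have [_ [B hB]] := bu.
have -> : u x = v t by rewrite /v subrKC.
apply: (@contraction_bound (fun y => `|v y - u y|)) => [||K hK y].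
- by rewrite e0 ltW.
- exists (B + B) => y; apply: (le_trans (ler_normB _ _)); apply: lerD; exact: hB.
(* With [z = y - t] the compared points are [y - t + x] and [y], so the shift is [x - t] at every
   [y]. *)
have [t1 t2] := hz (y - t).
have := logop_translate he hu t1 t2; rewrite subrK.
have -> : y - t + x - y = x - t by ring.
rewrite -/v => L1.
have L2 := hs (y - t + x).
have L3 := hs y.
have L4 : logop N a c v y <= logop N a c u y + K.
  apply: (@logop_le_shift R N a c N0 iN ca1) => // z; have := hK z; rewrite ler_norml; lra.
have L5 : logop N a c u y <= logop N a c v y + K.
  apply: (@logop_le_shift R N a c N0 iN ca1) => // z; have := hK z; rewrite ler_norml; lra.
have E : u (y - t + x) = v y by rewrite /v; congr u; ring.
rewrite E in L2; move: L1 L2 L3.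
set p1 := logop N a c v y in L4 L5 *; set p2 := logop N a c u (y - t + x).
set p3 := logop N a c u y in L4 L5 *.
rewrite !ler_norml => /andP[q1 q2] /andP[q3 q4] /andP[q5 q6].
have m1 : (1 - e) * p1 <= (1 - e) * (p3 + K) by rewrite ler_wpM2l//; lra.
have m2 : (1 - e) * p3 <= (1 - e) * (p1 + K) by rewrite ler_wpM2l//; lra.
have m3 : (1 - e) * p1 <= (1 - e) * (p2 + (CH + 1) * d) by rewrite ler_wpM2l//; lra.
have m4 : (1 - e) * p2 <= (1 - e) * (p1 + (CH + 1) * d) by rewrite ler_wpM2l//; lra.
have m5 : 0 <= e * ((CH + 1) * d) by rewrite mulr_ge0// ltW.
apply/andP; split; lra.
Qed.

(** Each of the two points is replaced by its representative in the net at cost [s / 4]; the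
    representatives are within [l] of each other, where weak Harnack costs another [s / 4]. *)
Lemma dsol_flat (s e1 : R) : 0 < s -> 0 < e1 -> exists2 e, 0 < e <= e1 &
  exists2 u, sol e u & forall x y, e * (u x - u y) <= s.
Proof.
move=> s0 e10; have C1 : 0 < CH + 1 by rewrite ltr_wpDl.
pose d := s / 8 / (CH + 1); have d0 : 0 < d by rewrite !divr_gt0.
have dE : (CH + 1) * d = s / 8 by rewrite mulrC divfK// gt_eqF.
have [ts hts] := net d0.
pose l := 1 + \sum_(t <- ts) `|t| *+ 2.
have hl t : t \in ts -> `|t| *+ 2 <= l - 1.
  rewrite /l addrAC subrr add0r => tts.
  by rewrite (big_rem t)//= lerDl sumr_ge0// => i _; rewrite mulrn_wge0.
have l0 : 0 < l by rewrite /l ltr_wpDr// sumr_ge0// => i _; rewrite mulrn_wge0.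
have s4 : 0 < s / 4 by rewrite divr_gt0.
have m0 : 0 < Num.min (Num.min e1 (s / 16)) (Num.min eH 2^-1).
  by rewrite !lt_min e10 eH0 divr_gt0//= invr_gt0 ltr0Sn.
have [e /andP[e0 he] hw] := weak_harnack N0 iN theta0 Delta0 k0 P0 Nlow Nup Ntail auc ca1
  lng0 lng01 l0 s4 m0.
move: he; rewrite le_min => /andP[]; rewrite le_min => /andP[ee1 es] he2.
have e1' : e < 1 by move: he2; rewrite le_min => /andP[_ ?]; lra.
have g00 : 0 < g0 by apply: lt_le_trans g01.
have [|u [u1 u2 u3]] :=
  @discounted_solution R N a c M A N0 iN NM Nuc auc ca1 caA e g0 g1 _ g00 hg0 hg1.
  by rewrite e0.
have hu : sol e u by split.
exists e; first by rewrite e0.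
exists u => // x y.
have [t tts ht] := hts x; have [t' tts' ht'] := hts y.
have ehe : 0 < e <= Num.min eH 2^-1 by rewrite e0.
have := dsol_translate ehe hu ht; have := dsol_translate ehe hu ht'.
rewrite dE => k1 k2.
have k3 : e * (u x - u t) <= e * `|u x - u t| by rewrite ler_pM2l// ler_norm.
have k4 : e * (u t' - u y) <= e * `|u y - u t'| by rewrite ler_pM2l// distrC ler_norm.
have k5 : e * (u t - u t') <= s / 4.
  apply: hw => //; apply: (le_trans (ler_normB _ _)).
  by have := hl _ tts; have := hl _ tts'; rewrite !mulr2n; lra.
lra.
Qed.

Lemma approximate_eigenfunction (eta : R) : 0 < eta -> exists phi lam,
  [/\ bounded_ucont phi, forall x, 1 <= phi x &
    forall x, `|convop N phi x - a x * phi x - lam * phi x| <= eta * phi x].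
Proof.
move=> eta0; pose C := expR (ln g1 + 1); have C0 : 0 < C by exact: expR_gt0.
(* [C] is the Lipschitz constant of [expR] below [ln g1 + 1]. The oscillation of [v] is at most
   [4 * s]: [s] from flatness and [s] from two residuals, doubled on dividing by
   [1 - e >= 1 / 2]. *)
pose s := eta / (4 * C); have s0 : 0 < s by rewrite divr_gt0// mulr_gt0.
have m0 : 0 < Num.min (s / 2) 2^-1 by rewrite lt_min divr_gt0//= invr_gt0.
have [e /andP[e0]] := dsol_flat s0 m0.
rewrite le_min => /andP[es e2] [u hu flat].
have eh : 0 < e <= 2^-1 by rewrite e0.
have [bu hs hb] := hu.
pose v x := logop N a c u x - u x.
have vb x : v x <= ln g1 + 1 by have /andP[] := logop_sub_bounds x eh hu.
have vosc x y : v x - v y <= 4 * s.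
  have := hs x; have := hs y; rewrite !ler_norml => /andP[q1 q2] /andP[q3 q4].
  have fl := flat x y.
  have h1 : (1 - e) * (v x - v y) <= 2 * s by rewrite /v; lra.
  have [vn|vp] := leP (v x - v y) 0; first lra.
  have : 2^-1 * (v x - v y) <= (1 - e) * (v x - v y) by rewrite ler_pM2r//; lra.
  lra.
exists (ex u), (expR (v 0) - c); split.
- exact: bounded_ucont_expR.
- by move=> x; rewrite -expR0 ler_expR (dsol_ge0 lng0 _ eh hu).
move=> x; rewrite (convop_logop N0 ca1) -/(v x).
have -> : (expR (v x) - (c - a x)) * expR (u x) - a x * expR (u x) -
  (expR (v 0) - c) * expR (u x) = (expR (v x) - expR (v 0)) * expR (u x) by ring.
rewrite normrM (ger0_norm (expR_ge0 (u x))) ler_wpM2r ?expR_ge0//.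
apply: (le_trans (expR_sub_le (vb x) (vb 0))).
rewrite -/C; have -> : eta = C * (4 * s) by rewrite /s; field; rewrite gt_eqF.
rewrite ler_pM2l// ler_norml; apply/andP; split; last exact: vosc.
by have := vosc 0 x; lra.
Qed.

End almost_periodicity.

(** * The tilted kernels and comparison on half-lines *)

Section kernel_family.
Context {R : realType}.
Variable K : R -> R -> R.
Hypothesis K0 : forall x y, 0 <= K x y.
Implicit Types (phi psi a : R -> R) (p x y s : R).

(** This is [K_p] in the displacement [s = x - y], where [p * (y - x)] becomes [- p * s]. *)
Definition ckernel p x s : R := K x (x - s) * expR (- p * s).

Hypothesis iK : forall p x, ig (ckernel p x).
Hypothesis KM : forall p, exists M, forall x, \int[leb]_s ckernel p x s <= M.

Lemma ckernel_ge0 p x s : 0 <= ckernel p x s.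
Proof. by rewrite mulr_ge0 ?expR_ge0. Qed.

Lemma ckernel_tilt p tau x s : ckernel p x s * expR (tau * s) = ckernel (p - tau) x s.
Proof. by rewrite /ckernel -mulrA -expRD; congr (_ * expR _); ring. Qed.

(** From [|exp (tau s) - 1| <= |tau| |s| exp |s|] and [|s| <= exp |s|]. The right-hand side is a sum
    of two tilts, so its integral against [ckernel] is controlled by [KM]. *)
Lemma tilt_sub_le (tau s : R) : `|tau| <= 1 ->
  `|expR (tau * s) - 1| <= `|tau| * (expR (2 * s) + expR (- 2 * s)).
Proof.
move=> t1.
have ns : `|tau * s| <= `|s| by rewrite normrM ler_piMl.
have h1 : `|expR (tau * s) - expR 0| <= expR `|s| * `|tau * s - 0|.
  by apply: expR_sub_le; [exact: le_trans (ler_norm _) ns|].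
rewrite expR0 subr0 in h1; apply: (le_trans h1).
rewrite normrM mulrCA ler_wpM2l//.
have h2 : `|s| <= expR `|s| by have := expR_ge1Dx `|s|; lra.
apply: (@le_trans _ _ (expR `|s| * expR `|s|)); first by rewrite ler_wpM2l ?expR_ge0.
rewrite -expRD; have [s0|s0] := leP 0 s.
  rewrite ger0_norm//; have -> : s + s = 2 * s by ring.
  by rewrite lerDl expR_ge0.
rewrite ltr0_norm//; have -> : - s + - s = - 2 * s by ring.
by rewrite lerDr expR_ge0.
Qed.

Lemma ckernel_tilt_diff p : exists2 M, 0 <= M & forall (tau B x : R) phi,
  `|tau| <= 1 -> measurable_fun setT phi -> (forall y, `|phi y| <= B) ->
  `|convop (ckernel (p - tau)) phi x - convop (ckernel p) phi x| <= `|tau| * (M * B).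
Proof.
have [M1 h1] := KM (p - 2); have [M2 h2] := KM (p + 2).
have p1 : 0 <= M1 by apply: le_trans (h1 0); apply: int_ge0 => s; exact: ckernel_ge0.
have p2 : 0 <= M2 by apply: le_trans (h2 0); apply: int_ge0 => s; exact: ckernel_ge0.
exists (M1 + M2); first exact: addr_ge0.
move=> tau B x phi t1 mphi bphi.
have B0 : 0 <= B := le_trans (normr_ge0 _) (bphi 0).
have j1 := integrable_convop (iK (p - tau)) x mphi bphi.
have j2 := integrable_convop (iK p) x mphi bphi.
have j3 := integrable_add (iK (p - 2) x) (iK (p + 2) x).
rewrite /convop -int_sub//.
apply: (@le_trans _ _ (\int[leb]_s ((`|tau| * B) * (ckernel (p - 2) x s + ckernel (p + 2) x s)))).
  apply: norm_int_le; [exact: (integrableB _ j1 j2)|exact: integrable_scale|].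
  move=> s; rewrite -!ckernel_tilt.
  have -> : ckernel p x s * expR (tau * s) * phi (x - s) - ckernel p x s * phi (x - s) =
    ckernel p x s * (expR (tau * s) - 1) * phi (x - s) by ring.
  have -> : ckernel (p + 2) x s = ckernel p x s * expR (- 2 * s).
    by rewrite ckernel_tilt; congr ckernel; ring.
  move: (ckernel p x s) (ckernel_ge0 p x s) => n n0.
  rewrite !normrM (ger0_norm n0) -mulrDr.
  have -> : `|tau| * B * (n * (expR (2 * s) + expR (- 2 * s))) =
    n * (`|tau| * (expR (2 * s) + expR (- 2 * s))) * B by ring.
  apply: ler_pM => //; first by rewrite mulr_ge0.
  by rewrite ler_wpM2l// tilt_sub_le.
rewrite int_scale// int_add// -mulrA ler_wpM2l// mulrC ler_wpM2r//.
by rewrite lerD.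
Qed.

(** Exponential Chebyshev bound: outside the window one of [expR (|q| * (s - r))] and
    [expR (|q| * (- s - r))] is at least 1. *)
Lemma ckernel_tail p : forall q, exists Mq, forall x r, 0 <= r ->
  \int[leb]_s (ckernel p x s * (1 - chi (- r) r s)) <= Mq * expR (- (q * r)).
Proof.
move=> q; have [M1 h1] := KM (p - `|q|); have [M2 h2] := KM (p + `|q|).
exists (M1 + M2) => x r r0.
have j3 := integrable_add (iK (p - `|q|) x) (iK (p + `|q|) x).
apply: (@le_trans _ _ (\int[leb]_s (expR (- (q * r)) *
    (ckernel (p - `|q|) x s + ckernel (p + `|q|) x s)))); last first.
  by rewrite int_scale// int_add// mulrC ler_wpM2r ?expR_ge0 ?lerD.
apply: int_le; [exact: integrable_tail|exact: integrable_scale|].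
move=> s; have n0 := ckernel_ge0.
rewrite /chi; case: ifP => [_|/negbT].
  by rewrite subrr mulr0 mulr_ge0 ?expR_ge0 ?addr_ge0.
have -> : ckernel (p + `|q|) x s = ckernel p x s * expR (- `|q| * s).
  by rewrite ckernel_tilt; congr ckernel; ring.
rewrite -ckernel_tilt negb_and -!ltNge subr0 -mulrDr mulrCA => rs.
rewrite ler_wpM2l// mulrDr -!expRD.
have qr : q * r <= `|q| * r by rewrite ler_wpM2r// ler_norm.
have e1 := expR_ge0 (- (q * r) + `|q| * s).
have e2 := expR_ge0 (- (q * r) + - `|q| * s).
case/orP: rs => rs.
  have : 1 <= expR (- (q * r) + - `|q| * s).
    rewrite -expR0 ler_expR.
    have : `|q| * r <= `|q| * - s by rewrite ler_wpM2l//; lra.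
    lra.
  lra.
have : 1 <= expR (- (q * r) + `|q| * s).
  rewrite -expR0 ler_expR.
  have : `|q| * r <= `|q| * s by rewrite ler_wpM2l//; lra.
  lra.
lra.
Qed.

(* Multiplying the supersolution by [1 + E exp (- tau (x - r))] makes it so large to the left of
   [r] that the optimal multiple of it above [phi] is almost attained inside the half-line. *)
Lemma half_line_comparison a p (r lam mu m B A : R) phi psi :
  0 < m -> (forall x, m <= phi x <= B) -> (forall x, m <= psi x <= B) ->
  measurable_fun setT phi -> measurable_fun setT psi -> (forall x, `|a x| <= A) ->
  (forall x, r < x -> lam * phi x <= convop (ckernel p) phi x - a x * phi x) ->
  (forall x, r < x -> convop (ckernel p) psi x - a x * psi x <= mu * psi x) ->
  lam <= mu.
Proof.
move=> m0 bphi bpsi mphi mpsi aA sub super; rewrite leNgt; apply/negP => lt_ml.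
have [M M0 hM] := ckernel_tilt_diff p.
have B0 : 0 < B by have /andP[] := bphi 0; lra.
have nphi y : `|phi y| <= B by have /andP[h1 h2] := bphi y; rewrite ger0_norm//; lra.
have npsi y : `|psi y| <= B by have /andP[h1 h2] := bpsi y; rewrite ger0_norm//; lra.
pose C := M * B / m + 1; have C0 : 0 < C.
  by rewrite ltr_wpDl// divr_ge0 ?mulr_ge0// ltW.
(* The tilt raises the value [mu] of the supersolution by at most [tau * C], kept within half of the
   gap. *)
pose tau := Num.min 1 ((lam - mu) / (2 * C)).
have tau0 : 0 < tau by rewrite lt_min ltr01 divr_gt0 ?mulr_gt0 ?subr_gt0.
have tau1 : `|tau| <= 1 by rewrite gtr0_norm// ge_min lexx.
have tauC : tau * C <= (lam - mu) / 2.
  rewrite -ler_pdivlMr//; apply: (@le_trans _ _ ((lam - mu) / (2 * C))).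
    by rewrite ge_min lexx orbT.
  by rewrite invfM mulrA.
(* Chosen so that [m / (2 * B) * (m * E) = B]: once [kap >= m / (2 * B)], [kap * Psi] dominates
   [phi] to the left of [r]. *)
pose E := 2 * B ^+ 2 / m ^+ 2; have E0 : 0 <= E.
  by rewrite divr_ge0 ?exprn_ge0 ?mulr_ge0 ?exprn_ge0// ltW.
pose w x := E * expR (- tau * (x - r)).
have w0 x : 0 <= w x by rewrite mulr_ge0 ?expR_ge0.
pose Psi x := psi x * (1 + w x).
have Psi0 x : 0 < Psi x.
  have /andP[h1 _] := bpsi x.
  by rewrite mulr_gt0 ?ltr_wpDr// (lt_le_trans m0).
have wr x : r < x -> w x <= E.
  move=> rx; rewrite ler_piMr// -expR0 ler_expR mulNr oppr_le0 mulr_ge0 ?(ltW tau0)//.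
  by rewrite subr_ge0 ltW.
have PsiB x : r < x -> Psi x <= B * (1 + E).
  move=> rx; have /andP[h1 h2] := bpsi x; have := wr _ rx; have := w0 x => k1 k2.
  by apply: ler_pM => //; lra.
pose S := [set phi x / Psi x | x in [set x | r < x]].
have S0 : has_sup S.
  split; first by exists (phi (r + 1) / Psi (r + 1)); exists (r + 1) => //=; lra.
  exists (B / m) => _ [x rx <-]; have /andP[h1 h2] := bpsi x; have /andP[h3 h4] := bphi x.
  apply: ler_pM; [lra|by rewrite invr_ge0 ltW|lra|].
  rewrite lef_pV2 ?posrE//; apply: (le_trans h1).
  by rewrite ler_peMr ?lerDl//; lra.
pose kap := sup S.
have kap_ge x : r < x -> phi x <= kap * Psi x.
  by move=> rx; rewrite -ler_pdivrMr//; apply: ub_le_sup; [exact: S0.2|exists x].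
have kap_low : m / (2 * B) <= kap.
  (* Far to the right the weight is at most 1, because [E <= expR (tau + E)]; this bounds [kap]
     below independently of [E]. *)
  pose x1 := r + 1 + E / tau.
  have rx1 : r < x1.
    have : 0 <= E / tau by rewrite divr_ge0// ltW.
    rewrite /x1; lra.
  have w1 : w x1 <= 1.
    rewrite /w /x1 mulNr expRN ler_pdivrMr ?expR_gt0// mul1r.
    have -> : tau * (r + 1 + E / tau - r) = tau + E by field; rewrite gt_eqF.
    by have := expR_ge1Dx (tau + E); lra.
  apply: (@le_trans _ _ (phi x1 / Psi x1)); last first.
    by apply: ub_le_sup; [exact: S0.2|exists x1].
  have /andP[h1 h2] := bpsi x1; have /andP[h3 h4] := bphi x1.
  apply: ler_pM => //; [exact: ltW|by rewrite invr_ge0 mulr_ge0 ?ltW|].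
  rewrite lef_pV2 ?posrE ?Psi0//; last by rewrite mulr_gt0.
  have : psi x1 * (1 + w x1) <= B * 2.
    by apply: ler_pM => //; have := w0 x1; lra.
  by rewrite [2 * B]mulrC.
have kap0 : 0 < kap by apply: lt_le_trans kap_low; rewrite divr_gt0 ?mulr_gt0.
have kap_all x : phi x <= kap * Psi x.
  have [xr|] := leP x r; last exact: kap_ge.
  have /andP[h1 h2] := bpsi x; have /andP[h3 h4] := bphi x.
  have w1 : E <= w x.
    rewrite /w ler_peMr// -expR0 ler_expR mulNr -mulrN mulr_ge0 ?(ltW tau0)//.
    by rewrite opprB subr_ge0.
  apply: (le_trans h4).
  apply: (@le_trans _ _ (m / (2 * B) * (m * E))).
    by rewrite /E le_eqVlt; apply/orP; left; apply/eqP; field; rewrite !gt_eqF.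
  apply: ler_pM => //; [by rewrite divr_ge0 ?mulr_ge0// ltW|by rewrite mulr_ge0// ltW|].
  by apply: ler_pM => //; [exact: ltW|lra].
have j1 x := integrable_convop (iK p) x mphi nphi.
have j2 x := integrable_convop (iK p) x mpsi npsi.
have j3 x := integrable_convop (iK (p - tau)) x mpsi npsi.
have PsiE x : (fun s => ckernel p x s * Psi (x - s)) = (fun s => ckernel p x s * psi (x - s) +
    w x * (ckernel (p - tau) x s * psi (x - s))).
  apply/funext => s; rewrite /Psi -ckernel_tilt /w.
  have -> : - tau * (x - s - r) = - tau * (x - r) + tau * s by ring.
  rewrite expRD; ring.
have j4 x : ig (fun s => ckernel p x s * Psi (x - s)).
  rewrite -[X in leb.-integrable _ X]/(EFin \o (fun s => ckernel p x s * Psi (x - s))) PsiE.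
  by apply: integrable_add => //; exact: integrable_scale.
(* Passing the exponential weight through the convolution changes [p] into [p - tau], which
   [ckernel_tilt_diff] compares with [p]. *)
have superPsi x : r < x -> convop (ckernel p) Psi x <= (mu + a x + tau * C) * Psi x.
  move=> rx; rewrite /convop PsiE int_add//; last exact: integrable_scale.
  rewrite int_scale// -!/(convop _ _ _).
  have /andP[h1 h2] := bpsi x.
  have k1 := super _ rx.
  have := hM tau B x psi tau1 mpsi npsi; rewrite (gtr0_norm tau0) ler_norml => /andP[_ k2].
  have k3 : M * B <= C * psi x.
    apply: (@le_trans _ _ (C * m)); last by rewrite ler_wpM2l// ltW.
    by rewrite /C mulrDl divfK ?gt_eqF// lerDl mul1r ltW.
  have k4 : tau * (M * B) <= tau * (C * psi x) by rewrite ler_wpM2l// ltW.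
  have k5 : convop (ckernel (p - tau)) psi x <= (mu + a x + tau * C) * psi x by lra.
  have k6 : w x * convop (ckernel (p - tau)) psi x <= w x * ((mu + a x + tau * C) * psi x).
    by rewrite ler_wpM2l.
  have k7 : 0 <= tau * (C * psi x) by rewrite !mulr_ge0 ?(ltW tau0) ?(ltW C0)//; lra.
  rewrite /Psi; lra.
have main x : r < x -> (lam + a x) * phi x <= kap * ((mu + a x + tau * C) * Psi x).
  move=> rx; apply: (@le_trans _ _ (convop (ckernel p) phi x)).
    by have := sub _ rx; lra.
  apply: (@le_trans _ _ (kap * convop (ckernel p) Psi x)); last first.
    by rewrite ler_wpM2l ?superPsi// ltW.
  rewrite /convop -int_scale//; apply: int_le => //; first exact: integrable_scale.
  by move=> s; rewrite mulrCA ler_wpM2l ?ckernel_ge0.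
pose Z := `|mu| + A + tau * C; have Z0 : 0 <= Z.
  by rewrite !addr_ge0 ?(le_trans _ (aA 0)) ?mulr_ge0 ?(ltW tau0) ?(ltW C0).
pose W := (Z + 1) * (B * (1 + E)); have W0 : 0 < W.
  rewrite /W; apply: mulr_gt0; first by rewrite ltr_wpDl.
  by apply: mulr_gt0 => //; rewrite ltr_wpDr.
pose g := (lam - mu) / 2 * m; have g0 : 0 < g by rewrite /g mulr_gt0// divr_gt0// subr_gt0.
(* At a point where the ratio is within [d] of its supremum, the defect [D] contributes at most
   [g / 2], while the gap contributes at least [g]. *)
pose d := g / (2 * W); have d0 : 0 < d by rewrite /d divr_gt0// mulr_gt0.
have [_ [x rx <-] dx] := sup_adherent d0 S0; rewrite -/kap in dx.
have /andP[h3 h4] := bphi x.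
have k1 : kap * Psi x - phi x <= d * Psi x.
  by move: dx; rewrite ltr_pdivlMr// => /ltW; lra.
have k2 := kap_ge _ rx; have k3 := main _ rx; have k4 := PsiB _ rx.
set D := kap * Psi x - phi x in k1.
have D0 : 0 <= D by rewrite subr_ge0.
have k5 : (lam - mu - tau * C) * phi x <= Z * D.
  have : (mu + a x + tau * C) * D <= Z * D.
    rewrite ler_wpM2r// /Z; have := ler_norm mu; have := ler_norm (a x); have := aA x; lra.
  rewrite /D; lra.
have k6 : g <= (lam - mu - tau * C) * phi x 
  by apply: ler_pM => //; [rewrite divr_ge0 ?subr_ge0 ?(ltW lt_ml)|exact: ltW|lra].
have k7 : Z * D <= Z * (d * (B * (1 + E))).
  by rewrite ler_wpM2l// (le_trans k1)// ler_wpM2l// ltW.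
have k8 : Z * (d * (B * (1 + E))) <= d * W.
  rewrite /W mulrCA ler_wpM2l ?(ltW d0)// ler_wpM2r ?lerDl// mulr_ge0 ?(ltW B0)// addr_ge0//.
have k9 : d * W = g / 2 by rewrite /d; field; rewrite gt_eqF.
lra.
Qed.

End kernel_family.

(** * Total boundedness and almost periodic functions *)

Section total_boundedness.
Context {R : realType}.
Implicit Types (a : R -> R) (P : R -> R -> Prop).

(** Otherwise each point could be chosen unrelated to all earlier ones; [L n] lists the first [n]
    choices. *)
Lemma finite_net P :
  (forall u : nat -> R, exists n m, (n < m)%N /\ P (u m) (u n)) ->
  exists ts : seq R, forall x, exists2 t, t \in ts & P x t.
Proof.
move=> hP; apply: contrapT => H.
have far (ts : seq R) : exists x, forall t, t \in ts -> ~ P x t.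
  apply: contrapT => H1; apply: H; exists ts => x.
  apply: contrapT => H2; apply: H1; exists x => t tts Pxt; apply: H2.
  by exists t.
have [g hg] := choice far.
pose L := fix L n : seq R := if n is n'.+1 then g (L n') :: L n' else [::].
have memL n m : (n < m)%N -> g (L n) \in L m.
  elim: m => // m IH; rewrite ltnS leq_eqVlt => /orP[/eqP ->|/IH h].
    by rewrite /= inE eqxx.
  by rewrite /= inE h orbT.
have [n [m [nm Pnm]]] := hP (fun n => g (L n)).
exact: hg (memL _ _ nm) Pnm.
Qed.

Lemma K9_uniform_cauchy a (u : nat -> R) : K9 a -> exists2 sigma, extraction sigma &
  forall d : R, 0 < d -> exists N, forall n m, (N <= n)%N -> (N <= m)%N ->
    forall x, `|a (x + u (sigma n)) - a (x + u (sigma m))| <= d.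
Proof.
move=> /(_ u)[sigma es [l hl]]; exists sigma => // d d0.
have d2 : 0 < d / 2 by rewrite divr_gt0.
have H : nbhs (l : {uniform R -> R}) [set g | forall y, `|l y - g y| < d / 2].
  apply/uniform_nbhs; exists [set xy | ball xy.1 (d / 2) xy.2]; split.
    exact: (entourage_ball _ (PosNum d2)).
  by move=> g /= hg y; exact: hg.
have [N _ hN] := hl _ H.
exists N => n m /hN/= h1 /hN/= h2 x; have := h1 x; have := h2 x.
rewrite !ltr_norml ler_norml => /andP[? ?] /andP[? ?]; apply/andP; split; lra.
Qed.

Lemma almost_periodic_net a (d : R) : K9 a -> 0 < d ->
  exists ts : seq R, forall x, exists2 t, t \in ts & forall z, `|a (z + x) - a (z + t)| <= d.
Proof.
move=> ha d0; apply: (@finite_net (fun x t => forall z, `|a (z + x) - a (z + t)| <= d)) => u.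
have [sigma es /(_ d d0)[N hN]] := K9_uniform_cauchy u ha.
exists (sigma N), (sigma N.+1); split; first by apply: es.
by move=> z; exact: hN.
Qed.

Lemma almost_periodic_bounded a : K9 a -> exists A, forall x, `|a x| <= A.
Proof.
move=> ha; have [ts hts] := almost_periodic_net ha ltr01.
exists (1 + \sum_(t <- ts) `|a t|) => x; have [t tts ht] := hts x.
have := ht 0; rewrite !add0r => h.
have : `|a t| <= \sum_(t <- ts) `|a t| by rewrite (big_rem t)//= lerDl sumr_ge0.
have := ler_normD (a x - a t) (a t); rewrite subrK; lra.
Qed.

(** Translation carries a close pair [x], [y] next to one of finitely many points [t], and
    continuity at those is uniform. *)
Lemma almost_periodic_ucont a : K9 a -> continuous a -> ucont a.
Proof.
move=> ha ca e e0; have e3 : 0 < e / 3 by rewrite divr_gt0.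
have [ts hts] := almost_periodic_net ha e3.
have [d d0 hd] : exists2 d : R, 0 < d &
    forall t, t \in ts -> forall x, `|t - x| < d -> `|a t - a x| <= e / 3.
  elim: ts {hts} => [|t ts [d d0 hd]]; first by exists 1.
  have [d1 /= d10 hd1] : exists2 d1 : R, 0 < d1 &
      forall x, `|t - x| < d1 -> `|a t - a x| <= e / 3.
    have /cvgrPdist_le/(_ _ e3)/nbhs_ballP[d1 /= d10 h] := ca t.
    by exists d1 => // x tx; exact: h.
  exists (Num.min d d1); first by rewrite lt_min d0.
  move=> t'; rewrite inE => /orP[/eqP ->|tts] x; rewrite lt_min => /andP[x1 x2].
    exact: hd1.
  exact: hd.
exists d => // x y xy; have [t tts ht] := hts x.
have h1 := ht 0; have h2 := ht (y - x); rewrite !add0r subrK in h1 h2.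
have h3 : `|a t - a (y - x + t)| <= e / 3.
  by apply: hd => //; rewrite opprD addrCA subrr addr0 opprB.
move: h1 h2 h3; rewrite !ler_norml => /andP[? ?] /andP[? ?] /andP[? ?].
apply/andP; split; lra.
Qed.

End total_boundedness.

(** * Approximate eigenfunctions in the two cases *)

Section approximate_eigenfunctions.
Context {R : realType}.
Variables (K : R -> R -> R) (a : R -> R) (theta Delta k0 A : R).
Hypotheses (K0 : forall x y, 0 <= K x y) (iK : forall p x, ig (ckernel K p x)).
Hypothesis KM : forall p, exists M, forall x, \int[leb]_s ckernel K p x s <= M.
Hypotheses (theta0 : 0 < theta) (Delta0 : 0 < Delta) (k00 : 0 < k0).
Hypotheses (Klow : forall x y, `|x - y| <= Delta -> theta <= K x y).
Hypothesis Kup : forall x y, K x y <= k0.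
Hypotheses (auc : ucont a) (aK9 : K9 a) (aA : forall x, `|a x| <= A).

Let c : R := A + 1.

Lemma shift_bounds x : 1 <= c - a x <= 2 * A + 1.
Proof. by have := aA x; rewrite /c ler_norml => /andP[? ?]; apply/andP; split; lra. Qed.

Let ca1 x : 1 <= c - a x. Proof. by case/andP: (shift_bounds x). Qed.
Let caA x : c - a x <= 2 * A + 1. Proof. by case/andP: (shift_bounds x). Qed.

Lemma ckernel_low (p x s : R) : `|s| <= Delta -> theta * expR (- `|p| * Delta) <= ckernel K p x s.
Proof.
move=> sD; apply: ler_pM; [exact: ltW|exact: expR_ge0|by apply: Klow; rewrite subKr|].
rewrite ler_expR !mulNr lerN2; apply: (le_trans (ler_norm _)).
by rewrite normrM ler_wpM2l.
Qed.

Lemma ckernel_up (p x s : R) : ckernel K p x s <= k0 * expR (`|p| * `|s|).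
Proof.
apply: ler_pM => //.
by rewrite ler_expR mulNr (le_trans (ler_norm _))// normrN normrM.
Qed.

Let theta_p (p : R) : 0 < theta * expR (- `|p| * Delta).
Proof. by rewrite mulr_gt0 ?expR_gt0. Qed.

Lemma tilted_approximate_eigenfunction (p M g0 : R) :
  (forall x, \int[leb]_s ckernel K p x s <= M) ->
  (forall e : R, 0 < e -> exists2 d : R, 0 < d & forall x y, `|x - y| < d ->
     \int[leb]_s `|ckernel K p x s - ckernel K p y s| <= e) ->
  (forall d : R, 0 < d -> exists ts : seq R, forall x, exists2 t, t \in ts &
     forall z, `|a (z + x) - a (z + t)| <= d /\
     \int[leb]_s `|ckernel K p (z + x) s - ckernel K p (z + t) s| <= d) ->
  1 <= g0 -> (forall x, g0 <= \int[leb]_s ckernel K p x s + (c - a x)) ->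
  (exists CH eH, [/\ 0 <= CH, 0 < eH & forall e u, 0 < e <= eH ->
     dsol (ckernel K p) a c (ln g0) (ln (M + (2 * A + 1))) e u -> forall x t d,
     \int[leb]_s `|ckernel K p x s - ckernel K p t s| <= d ->
     \int[leb]_s (`|ckernel K p x s - ckernel K p t s| * expR (u (x - s)))
       <= CH * d * expR (u x)]) ->
  forall eta : R, 0 < eta -> exists phi lam,
  [/\ bounded_ucont phi, forall x, 1 <= phi x &
    forall x, `|convop (ckernel K p) phi x - a x * phi x - lam * phi x| <= eta * phi x].
Proof.
move=> NM Nuc net g01 hg0 [CH [eH [CH0 eH0 err]]] eta eta0.
have low := @ckernel_low p; have up := @ckernel_up p.
have hg1 x : \int[leb]_s ckernel K p x s + (c - a x) <= M + (2 * A + 1) by apply: lerD.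
exact: (approximate_eigenfunction (ckernel_ge0 K0 p) (iK p) NM Nuc (theta_p p) Delta0
  (ltW k00) (normr_ge0 p) low up (ckernel_tail K0 iK KM p) auc ca1 caA g01 hg0 hg1 net
  CH0 eH0 err).
Qed.

(** [ckernel K p x] does not depend on [x]: kernel differences vanish, [CH = 0], and almost periods
    of [a] suffice. *)
Lemma convolution_approximate_eigenfunction (J : R -> R) (p : R) :
  (forall x y, K x y = J (x - y)) -> forall eta : R, 0 < eta -> exists phi lam,
  [/\ bounded_ucont phi, forall x, 1 <= phi x &
    forall x, `|convop (ckernel K p) phi x - a x * phi x - lam * phi x| <= eta * phi x].
Proof.
move=> KJ; have [M hM] := KM p.
have inv x y s : ckernel K p x s = ckernel K p y s by rewrite /ckernel !KJ !subKr.
have zero x y : \int[leb]_s `|ckernel K p x s - ckernel K p y s| = 0.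
  rewrite (int_ext (g := cst 0)); first by rewrite Rintegral_cst// mul0r.
  by move=> s /=; rewrite (inv x y) subrr normr0.
apply: (@tilted_approximate_eigenfunction p M 1) => //.
- by move=> e e0; exists 1 => // x y _; rewrite zero ltW.
- move=> d d0; have [ts hts] := almost_periodic_net aK9 d0.
  exists ts => x; have [t tts ht] := hts x; exists t => // z; split => //.
  by rewrite zero ltW.
- move=> x; have : 0 <= \int[leb]_s ckernel K p x s by apply: int_ge0 => s; exact: ckernel_ge0.
  by have := ca1 x; lra.
- exists 0, 1; split => // e u _ _ x t d _.
  rewrite (int_ext (g := cst 0)); first by rewrite Rintegral_cst// !mul0r.
  by move=> s /=; rewrite (inv x t) subrr normr0 mul0r.
Qed.

Variable r0 : R.
Hypotheses (r00 : 0 < r0) (Kr0 : forall x y, r0 <= `|x - y| -> K x y = 0).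

Lemma ckernel_support (p x s : R) : r0 <= `|s| -> ckernel K p x s = 0.
Proof. by move=> h; rewrite /ckernel Kr0 ?mul0r// subKr. Qed.

(** By compact support, integrating over the ball of radius [r0] is integrating over the whole
    line. *)
Lemma Kp_dist_lt (p x y e : R) : (Kp_dist K p r0 x y < e%:E)%E ->
  \int[leb]_s `|ckernel K p x s - ckernel K p y s| <= e.
Proof.
have -> : Kp_dist K p r0 x y = (\int[leb]_s (`|ckernel K p x s - ckernel K p y s|)%:E)%E.
  rewrite /Kp_dist integral_mkcond; apply: eq_integral => s _; rewrite patchE.
  case: ifPn => [_|]; first by rewrite /Kp /ckernel !(addrC _ (- s)) !addrK !mulrN !mulNr.
  rewrite notin_setE /ball/= sub0r normrN => /negP; rewrite -leNgt => h.
  by rewrite !ckernel_support// subrr normr0.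
move=> h; rewrite /Rintegral -lee_fin fineK; first exact: ltW.
rewrite ge0_fin_numE ?integral_ge0//.
exact: lt_trans h (ltry _).
Qed.

(** [convop phi] is comparable with [phi] from both sides: at most [C * phi], and at least
    [kappa / 2 * phi] for small [e]. The tail term of [convop_compare] is zero, so no constant
    depends on [e]. *)
Lemma full_harnack (p kappa g0 g1 : R) : 0 < kappa -> 1 <= g0 -> g0 <= g1 ->
  (forall x, kappa <= g0 - c + a x) ->
  exists CH eH, [/\ 0 <= CH, 0 < eH & forall e u, 0 < e <= eH ->
    dsol (ckernel K p) a c (ln g0) (ln g1) e u ->
    forall x s, `|s| <= r0 -> expR (u (x - s)) <= CH * expR (u x)].
Proof.
move=> kap0 g01 gg hk; set th := theta * expR (- `|p| * Delta).
have th0 : 0 < th by exact: theta_p.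
have g00 : 0 < g0 by apply: lt_le_trans g01.
have l0 : 0 <= ln g0 by exact: ln_ge0.
have l1 : ln g0 <= ln g1 by rewrite ler_ln// posrE (lt_le_trans g00).
pose C := expR (ln g1 + 1); have C0 : 0 <= C by exact: expR_ge0.
pose h : R := Delta / 2; have h0 : 0 < h by rewrite divr_gt0.
pose Q : R := 3 + C / (th * h).
have Q0 : 0 <= Q by rewrite /Q addr_ge0// divr_ge0// ltW// mulr_gt0.
pose m := (Num.truncn (r0 / h)).+1.
have mr : r0 <= m%:R * h by rewrite -ler_pdivrMr// ltW// truncnS_gt.
pose Z := k0 / th * (expR (`|p| * (m%:R * h)) * Q ^+ (m + m)).
have Z0 : 0 <= Z by rewrite !mulr_ge0 ?exprn_ge0 ?expR_ge0 ?invr_ge0 ?(ltW th0) ?(ltW k00).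
(* The bound [kappa / (4 * g0)] on [e] keeps the loss [g0 * (2 * e)] in the lower bound for
   [convop phi / phi] at most [kappa / 2]. *)
exists (2 / kappa * (Z * C)), (Num.min 2^-1 (kappa / (4 * g0))); split.
- by rewrite mulr_ge0 ?divr_ge0 ?(ltW kap0)// mulr_ge0.
- by rewrite lt_min divr_gt0 ?mulr_gt0//= invr_gt0 ltr0Sn.
move=> e u /andP[e0]; rewrite le_min => /andP[e2 ek] hu x s sr.
have eh : 0 < e <= 2^-1 by rewrite e0.
have N0 := ckernel_ge0 K0 p; have iN := iK p.
have low y : expR (u y) <= 2 / kappa * convop (ckernel K p) (fun y => expR (u y)) y.
  rewrite mulrAC ler_pdivlMr// mulrC -ler_pdivrMl// mulrA.
  rewrite (convop_logop N0 ca1) ler_wpM2r ?expR_ge0//.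
  have /andP[lo _] := logop_sub_bounds y eh hu.
  have k1 : g0 * expR (- (2 * e)) <= expR (logop (ckernel K p) a c u y - u y).
    by rewrite -[g0 in leLHS]lnK ?posrE// -expRD ler_expR.
  have k2 : g0 * (1 - 2 * e) <= g0 * expR (- (2 * e)).
    by rewrite ler_pM2l//; have := expR_ge1Dx (- (2 * e)); lra.
  have k3 : g0 * (2 * e) <= kappa / 2.
    by move: ek; rewrite ler_pdivlMr ?mulr_gt0// => ek; lra.
  by have := hk y; lra.
have up y := convop_le_dsol N0 ca1 y eh hu.
have -> : 2 / kappa * (Z * C) * expR (u x) = 2 / kappa * (Z * (C * expR (u x))) by ring.
apply: (le_trans (low _)); rewrite ler_wpM2l ?divr_ge0 ?(ltW kap0)//.
have tail0 : \int[leb]_y (ckernel K p (x - s) y * (1 - chi (- (m%:R * h)) (m%:R * h) y)) <= 0.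
  rewrite (int_ext (g := cst 0)); first by rewrite Rintegral_cst// mul0r.
  move=> s' /=; rewrite /chi; case: ifPn => [_|]; first by rewrite subrr mulr0.
  rewrite subr0 mulr1 negb_and -!ltNge => hs; apply: ckernel_support.
  have := ler_norm s'; have := ler_norm (- s'); rewrite normrN.
  by case/orP: hs; lra.
have xx' : `|x - s - x| <= m%:R * h by rewrite addrAC subrr add0r normrN (le_trans sr).
have := @convop_compare R _ th Delta k0 `|p| N0 iN th0 Delta0 (ltW k00) (normr_ge0 _)
  (@ckernel_low p) (@ckernel_up p) (fun y => expR (u y)) C (expR (ln g1 / e))
  (fun y => expR_ge0 _) (fun y => dsol_bound l0 l1 y eh hu) (dsol_measurable hu) C0 up
  (x - s) x m m 0 xx' tail0.
rewrite -/h -/Q -/Z mul0r addr0 => H; apply: (le_trans H).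
by rewrite ler_wpM2l.
Qed.

Hypothesis K8r : K8 K r0.
Hypothesis K6r : K6 K.
Variable kappa : R.
Hypothesis kappa0 : 0 < kappa.
Hypothesis kappaP : forall p x y z, kappa <= \int[leb]_s ckernel K p x s - a y + a z.

Lemma compact_support_approximate_eigenfunction (p : R) :
  forall eta : R, 0 < eta -> exists phi lam,
  [/\ bounded_ucont phi, forall x, 1 <= phi x &
    forall x, `|convop (ckernel K p) phi x - a x * phi x - lam * phi x| <= eta * phi x].
Proof.
have [M hM] := KM p.
have hi : has_inf (range a).
  split; first by exists (a 0), 0.
  by exists (- A) => _ [x _ <-]; have := aA x; rewrite ler_norml => /andP[].
pose ia := inf (range a).
have iaP x : ia <= a x by apply: ge_inf; [exact: hi.2|exists x].
(* The discounted solutions satisfy [convop phi >= (g0 - c + a - O(e)) * phi], so this choice turns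
   [kappa > 0] into a lower bound for [convop phi / phi]. *)
pose g0 := kappa + c - ia.
have g0x x : g0 <= \int[leb]_s ckernel K p x s + (c - a x).
  have : kappa - (\int[leb]_s ckernel K p x s - a x) <= ia.
    apply: lb_le_inf; first exact: hi.1.
    by move=> _ [z _ <-]; have := kappaP p x x z; lra.
  by rewrite /g0; lra.
have g01 : 1 <= g0.
  by have := iaP 0; have := ca1 0; rewrite /g0; have k0' := kappa0; lra.
have gg : g0 <= M + (2 * A + 1).
  by apply: (le_trans (g0x 0)); apply: lerD.
have hk x : kappa <= g0 - c + a x by have := iaP x; rewrite /g0; lra.
apply: (@tilted_approximate_eigenfunction p M g0) => //.
- move=> e e0; have /nbhs_ballP[d /= d0 hd] := K6r p r00 e0.
  exists d => // x y xy; apply: Kp_dist_lt.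
  have -> : y = x + (y - x) by rewrite subrKC.
  by apply: hd; rewrite /ball/= sub0r normrN distrC.
- move=> d d0; apply: (@finite_net _ (fun x t => forall z, `|a (z + x) - a (z + t)| <= d /\
     \int[leb]_s `|ckernel K p (z + x) s - ckernel K p (z + t) s| <= d)) => u.
  (* One extraction for [a], then a second along it for the kernel; [s2 j >= j] keeps the indices
     large enough for [a]. *)
  have [s1 e1 /(_ d d0)[N1 h1]] := K9_uniform_cauchy u aK9.
  have [s2 e2 /(_ d d0)[N2 h2]] := K8r p (u \o s1).
  pose n := maxn N1 N2.
  have le_id : forall j, (j <= s2 j)%N.
    by elim=> // j IH; apply: (leq_ltn_trans IH); apply: e2.
  exists (s1 (s2 n)), (s1 (s2 n.+1)); split; first by apply: e1; apply: e2.
  move=> z; split.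
    apply: h1; apply: leq_trans (le_id _); last exact: leq_maxl.
    by apply: leqW; exact: leq_maxl.
  apply: Kp_dist_lt; apply: h2; last exact: leq_maxr.
  by apply: leqW; exact: leq_maxr.
- have [CH [eH [CH0 eH0 H]]] := full_harnack p kappa0 g01 gg hk.
  exists CH, eH; split => // e u he hu x t d hd.
  have iabs := integrable_norm_sub (iK p x) (iK p t).
  have eh0 := H e u he hu x.
  apply: (@le_trans _ _ (\int[leb]_s ((CH * expR (u x)) * `|ckernel K p x s - ckernel K p t s|))).
    have bnd s : `|ckernel K p x s - ckernel K p t s| * expR (u (x - s)) <=
        CH * expR (u x) * `|ckernel K p x s - ckernel K p t s|.
      have [sr|rs] := leP `|s| r0; first by rewrite mulrC ler_wpM2r// eh0.
      by rewrite !ckernel_support ?(ltW rs)// subrr normr0 mul0r mulr0.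
    apply: int_le => //; last exact: integrable_scale.
    apply: (integrable_dominated _ _ (integrable_scale (CH * expR (u x)) iabs)) => [|s]; last first.
      by rewrite normrM normr_id (ger0_norm (expR_ge0 _)).
    apply: measurable_funM; first exact: integrable_measurable iabs.
    by apply: (@measurable_sub_reflect R (fun y => expR (u y))); exact: dsol_measurable hu.
  rewrite int_scale//.
  have -> : CH * d * expR (u x) = CH * expR (u x) * d by ring.
  by rewrite ler_wpM2l// mulr_ge0 ?expR_ge0.
Qed.

End approximate_eigenfunctions.

(** * The generalized principal eigenvalues and their continuity in [p] *)

Section principal_eigenvalue.
Context {R : realType}.
Variables (K : R -> R -> R) (a : R -> R) (A : R).
Hypotheses (K0 : forall x y, 0 <= K x y) (iK : forall p x, ig (ckernel K p x)).
Hypothesis KM : forall p, exists M, forall x, \int[leb]_s ckernel K p x s <= M.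
Hypothesis aA : forall x, `|a x| <= A.
Hypothesis approx : forall p (eta : R), 0 < eta -> exists phi lam,
  [/\ bounded_ucont phi, forall x, 1 <= phi x &
    forall x, `|convop (ckernel K p) phi x - a x * phi x - lam * phi x| <= eta * phi x].
Implicit Types (phi psi : R -> R) (p x y : R).

Lemma Lop_convop p phi x B : measurable_fun setT phi -> (forall y, `|phi y| <= B) ->
  Lop K a p phi x = convop (ckernel K p) phi x - a x * phi x.
Proof.
move=> mphi bphi; rewrite /Lop; congr (_ - _).
have i1 := integrable_convop (iK p) x mphi bphi.
have i2 := integrable_reflect x i1.
rewrite /convop -(int_reflect x i1); apply: int_ext => y /=.
by rewrite /ckernel !subKr; congr (_ * expR _ * _); ring.
Qed.

Lemma calA_bounds phi : calA phi -> measurable_fun setT phi /\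
  exists m B, 0 < m /\ forall x, m <= phi x <= B.
Proof.
move=> [uc i0 sy]; split.
  apply: ucont_measurable => e e0; have [d d0 hd] := (unif_continuousP phi).1 uc e e0.
  by exists d => // x y xy; apply: ltW; apply: (hd (x, y)).
have lo x : (ereal_inf (range (fun x => (phi x)%:E)) <= (phi x)%:E)%E.
  by apply: ereal_inf_lbound; exists x.
have up x : ((phi x)%:E <= ereal_sup (range (fun x => (phi x)%:E)))%E.
  by apply: ereal_sup_ubound; exists x.
move: i0 sy lo up; set I := ereal_inf _; set S := ereal_sup _.
case: I => [m| |] // m0; last by move=> _ /(_ 0).
case: S => [B| |] // _ lo up; last by have := up 0.
exists m, B; split; first by rewrite -lte_fin.
by move=> x; rewrite -!lee_fin lo up.
Qed.

Lemma bounded_ucont_calA phi : bounded_ucont phi -> (forall x, 1 <= phi x) -> calA phi.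
Proof.
move=> [hu [B hB]] h1; split; first exact: ucont_unif_continuous.
  apply: (@lt_le_trans _ _ 1%E); first by rewrite lte_fin.
  by apply: le_ereal_inf_tmp => _ [x _ <-]; rewrite lee_fin.
apply: (@le_lt_trans _ _ B%:E); last exact: ltry.
by apply: ge_ereal_sup => _ [x _ <-]; rewrite lee_fin (le_trans (ler_norm _)).
Qed.

Definition subvalue p (r lam : R) := exists2 phi, calA phi &
  forall x, halfline r%:E x -> lam * phi x <= Lop K a p phi x.

Definition supervalue p (r lam : R) := exists2 phi, calA phi &
  forall x, halfline r%:E x -> Lop K a p phi x <= lam * phi x.

Lemma subvalue_le_supervalue p r lam mu : subvalue p r lam -> supervalue p r mu -> lam <= mu.
Proof.
move=> [phi /calA_bounds[m1 [l1 [B1 [l10 h1]]]] sub].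
move=> [psi /calA_bounds[m2 [l2 [B2 [l20 h2]]]] super].
have n1 y : `|phi y| <= B1 by have /andP[? ?] := h1 y; rewrite ger0_norm//; lra.
have n2 y : `|psi y| <= B2 by have /andP[? ?] := h2 y; rewrite ger0_norm//; lra.
have bnd (g : R -> R) l B : (forall x, l <= g x <= B) -> 
    Num.min l1 l2 <= l -> B <= Num.max B1 B2 ->
    forall x, Num.min l1 l2 <= g x <= Num.max B1 B2.
  by move=> h k1 k2 x; have /andP[? ?] := h x; rewrite (le_trans k1)//= (le_trans _ k2).
apply: (@half_line_comparison R K K0 iK KM a p r lam mu (Num.min l1 l2)
  (Num.max B1 B2) A phi psi) => //.
- by rewrite lt_min l10.
- by apply: (bnd _ l1 B1) => //; rewrite ?ge_min ?le_max lexx.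
- by apply: (bnd _ l2 B2) => //; rewrite ?ge_min ?le_max lexx orbT.
- by move=> x rx; rewrite -(Lop_convop p x m1 n1); apply: sub; rewrite /halfline/= lte_fin.
- by move=> x rx; rewrite -(Lop_convop p x m2 n2); apply: super; rewrite /halfline/= lte_fin.
Qed.

Lemma approximate_values p (eta : R) : 0 < eta ->
  exists lam, forall r, subvalue p r (lam - eta) /\ supervalue p r (lam + eta).
Proof.
move=> eta0; have [phi [lam [bu h1 h]]] := approx p eta0.
have hA := bounded_ucont_calA bu h1.
have [/ucont_measurable mphi [B hB]] := bu.
exists lam => r; split; exists phi => // x _; rewrite (Lop_convop p x mphi hB);
  have := h x; rewrite ler_norml => /andP[k1 k2]; lra.
Qed.

(** [h] is the supremum of the subvalues over all half-lines. One approximate eigenfunction gives a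
    subvalue and a supervalue, [2 * eta] apart and valid on every half-line, and [h] lies between
    them. *)
Lemma principal_eigenvalue_exists p : exists h : R, [/\
  forall r, lambda1_low K a p r%:E = h%:E, forall r, lambda1_up K a p r%:E = h%:E
  & forall eta : R, 0 < eta -> forall r, subvalue p r (h - eta) /\ supervalue p r (h + eta)].
Proof.
have [lam1 v1] := approximate_values p ltr01.
pose S : set R := [set lam | exists r, subvalue p r lam].
have S0 : has_sup S.
  split; first by exists (lam1 - 1), 0; exact: (v1 0).1.
  by exists (lam1 + 1) => l [r hl]; exact: subvalue_le_supervalue hl (v1 r).2.
pose h := sup S.
have subh r l : subvalue p r l -> l <= h by move=> hl; apply: ub_le_sup; [exact: S0.2|exists r].
have suph l : (forall r, supervalue p r l) -> h <= l.
  move=> hl; apply: ge_sup; first exact: S0.1.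
  by move=> l' [r hl']; exact: subvalue_le_supervalue hl' (hl r).
have ap (eta : R) : 0 < eta -> forall r, subvalue p r (h - eta) /\ supervalue p r (h + eta).
  move=> eta0; have e2 : 0 < eta / 2 by rewrite divr_gt0.
  have [lam v] := approximate_values p e2.
  have k1 := subh _ _ (v 0).1; have k2 := suph _ (fun r => (v r).2).
  move=> r; have [[phi hphi sub] [psi hpsi super]] := v r; split.
    exists phi => // x rx; apply: le_trans (sub x rx); rewrite ler_wpM2r//; last lra.
    by have [_ [m [B [m0 /(_ x)/andP[? ?]]]]] := calA_bounds hphi; lra.
  exists psi => // x rx; apply: (le_trans (super x rx)); rewrite ler_wpM2r//; last lra.
  by have [_ [m [B [m0 /(_ x)/andP[? ?]]]]] := calA_bounds hpsi; lra.
have lowE r : (h%:E <= lambda1_low K a p r%:E)%E.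
  apply/lee_addgt0Pr => e e0; rewrite -leeBlDr// -EFinB.
  by apply: ereal_sup_ubound; exists (h - e) => //; exact: (ap e e0 r).1.
have upE r : (lambda1_up K a p r%:E <= h%:E)%E.
  apply/lee_addgt0Pr => e e0; rewrite -EFinD.
  by apply: ereal_inf_lbound; exists (h + e) => //; exact: (ap e e0 r).2.
have le r : (lambda1_low K a p r%:E <= lambda1_up K a p r%:E)%E.
  apply: ge_ereal_sup => _ [l hl <-]; apply: le_ereal_inf_tmp => _ [l' hl' <-].
  by rewrite lee_fin; exact: subvalue_le_supervalue hl hl'.
exists h; split => // r; apply/eqP; rewrite eq_le.
  by rewrite lowE (le_trans (le r) (upE r)).
by rewrite upE (le_trans (lowE r) (le r)).
Qed.

(** The limits in [r] are limits of constants. For continuity, the approximate eigenfunction at [p]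
    is reused as a test function at [p - tau], with error [e / 3] from the equation and [e / 6] from
    the tilt. *)
Lemma H_real : exists h : R -> R, [/\
  forall p, H_low K a p = (h p)%:E, forall p, H_up K a p = (h p)%:E,
  forall p r lam, subvalue p r lam -> lam <= h p & continuous h].
Proof.
have [h hh] := choice principal_eigenvalue_exists.
have sub p r lam : subvalue p r lam -> lam <= h p.
  have [lowE _ _] := hh p => hl; rewrite -lee_fin -(lowE r).
  by apply: ereal_sup_ubound; exists lam.
have sup p r lam : supervalue p r lam -> h p <= lam.
  have [_ upE _] := hh p => hl; rewrite -lee_fin -(upE r).
  by apply: ereal_inf_lbound; exists lam.
exists h; split => //.
- move=> p; have [lowE _ _] := hh p; rewrite /H_low.
  by rewrite (_ : (fun r : R => _) = cst (h p)%:E) ?lim_cst//; apply/funext => r; exact: lowE.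
- move=> p; have [_ upE _] := hh p; rewrite /H_up.
  by rewrite (_ : (fun r : R => _) = cst (h p)%:E) ?lim_cst//; apply/funext => r; exact: upE.
move=> p; apply/cvgrPdist_le => e e0.
have e3 : 0 < e / 3 by rewrite divr_gt0.
have [phi [lam [bu h1 hphi]]] := approx p e3.
have hA := bounded_ucont_calA bu h1.
have [/ucont_measurable mphi [B hB]] := bu.
have B0 : 0 <= B := le_trans (normr_ge0 _) (hB 0).
have [M M0 hM] := ckernel_tilt_diff K0 iK KM p.
have near_p tau : `|tau| <= 1 -> `|tau| * (M * B) <= e / 6 -> `|h (p - tau) - lam| <= e / 2.
  move=> t1 t2; have diff x := le_trans (hM tau B x phi t1 mphi hB) t2.
  have bd x : `|Lop K a (p - tau) phi x - lam * phi x| <= e / 2 * phi x.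
    rewrite (Lop_convop _ x mphi hB); have := diff x; have := hphi x; have := h1 x.
    have : e / 6 * 1 <= e / 6 * phi x by rewrite ler_wpM2l//; lra.
    rewrite !ler_norml => q0 q1 /andP[q2 q3] /andP[q4 q5]; apply/andP; split; lra.
  have s1 : lam - e / 2 <= h (p - tau).
    apply: (sub _ 0); exists phi => // x _; have := bd x; rewrite ler_norml => /andP[]; lra.
  have s2 : h (p - tau) <= lam + e / 2.
    apply: (sup _ 0); exists phi => // x _; have := bd x; rewrite ler_norml => /andP[]; lra.
  by rewrite ler_norml; apply/andP; split; lra.
pose d := Num.min 1 (e / 6 / (M * B + 1)).
have MB : 0 <= M * B by rewrite mulr_ge0.
have d0 : 0 < d by rewrite lt_min ltr01 divr_gt0 ?divr_gt0// ltr_wpDl.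
have hp := near_p 0; rewrite subr0 normr0 mul0r in hp.
have {}hp : `|h p - lam| <= e / 2 by apply: hp => //; lra.
apply/nbhs_ballP; exists d => //= q; rewrite /ball/= lt_min => /andP[/ltW q1 q2].
have q3 : `|p - q| * (M * B) <= e / 6.
  apply: (@le_trans _ _ (e / 6 / (M * B + 1) * (M * B + 1))); last first.
    by rewrite divfK// gt_eqF// ltr_wpDl.
  by apply: ler_pM => //; [exact: ltW|rewrite lerDl].
have := near_p (p - q) q1 q3; rewrite subKr; move: hp; rewrite !ler_norml.
by move=> /andP[? ?] /andP[? ?]; apply/andP; split; lra.
Qed.

End principal_eigenvalue.

(** * Attainment of a coercive minimum *)

Section minimum.
Context {R : realType}.

Lemma coercive_min (F : R -> R) :
  (forall p, 0 < p -> {for p, continuous F}) ->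
  (\forall p \near +oo, F 1 <= F p) -> (\forall p \near 0^'+, F 1 <= F p) ->
  exists2 q, 0 < q & forall p, 0 < p -> F q <= F p.
Proof.
move=> cF [P [_ hP]] /nbhs_ballP[d /= d0 hd].
pose lo := Num.min 1 (d / 2); pose hi := Num.max 1 (P + 1).
have lo0 : 0 < lo by rewrite lt_min ltr01 divr_gt0.
have lohi : lo <= hi by rewrite /lo /hi ge_min le_max lexx.
have [|q] := @EVT_min R F lo hi lohi.
  apply: continuous_in_subspaceT => p; rewrite inE /= in_itv/= => /andP[h1 h2].
  by apply: cF; exact: lt_le_trans h1.
rewrite in_itv/= => /andP[q1 q2] hq.
have q0 : 0 < q by exact: lt_le_trans q1.
have F1 : F q <= F 1 by apply: hq; rewrite in_itv/= /lo /hi ge_min le_max lexx.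
exists q => // p p0; have [pl|lp] := ltP p lo.
  apply: (le_trans F1); apply: hd => //=; rewrite /ball/= sub0r normrN gtr0_norm//.
  by move: pl; rewrite lt_min => /andP[_ h]; lra.
have [ph|hp] := leP p hi; first by apply: hq; rewrite in_itv/= lp.
apply: (le_trans F1); apply: hP.
by move: hp; rewrite gt_max => /andP[_ h]; lra.
Qed.

End minimum.

(** * Consequences of the stated conditions *)

Section conditions.
Context {R : realType}.
Variables (K f : R -> R -> R).
Hypothesis K0 : forall x y, 0 <= K x y.
Hypothesis f_nonlin : nonlinearity f.
Hypothesis hK1 : K1 K.

Lemma K1_integrable p x : ig (ckernel K p x).
Proof. by have [_ h _] := hK1; exact: h. Qed.

Lemma K1_bounded p : exists M, forall x, \int[leb]_s ckernel K p x s <= M.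
Proof.
have [_ _ /(_ p)[[M [_ hM]] _]] := hK1; exists (M + 1) => x.
apply: le_trans (hM (M + 1) _ x I); last by rewrite ltrDl.
exact: ler_norm.
Qed.

Lemma intKp_ckernel p x : intKp K p x = \int[leb]_s ckernel K p x s.
Proof.
rewrite -(int_reflect x (K1_integrable p x)); apply: int_ext => y.
by rewrite /Kp /ckernel subKr; congr (_ * expR _); ring.
Qed.

Lemma b_ckernel x : b_ K x = \int[leb]_s ckernel K 0 x s.
Proof.
by rewrite -intKp_ckernel; apply: int_ext => y; rewrite /Kp mul0r expR0 mulr1.
Qed.

Lemma a_continuous : continuous (a_ K f).
Proof.
have [_ _ _ cfs _] := f_nonlin; have [_ _ /(_ 0)[_ cb]] := hK1.
have -> : a_ K f = fun x => intKexp K 0 x - fs0 f x.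
  by apply/funext => x; rewrite /a_ b_ckernel.
by move=> x; apply: continuousB; [exact: cb|exact: cfs].
Qed.

(** [kappa] is positive and bounded above by real numbers, hence itself real. *)
Lemma kappa_lower (A : R) : (forall x, `|a_ K f x| <= A) -> (0 < kappa K f)%E ->
  exists2 kap : R, 0 < kap &
    forall p x y z, kap <= \int[leb]_s ckernel K p x s - a_ K f y + a_ K f z.
Proof.
move=> aA kpos.
have bnd p x y z : (kappa K f <= (\int[leb]_s ckernel K p x s - a_ K f y + a_ K f z)%:E)%E.
  rewrite EFinD EFinB /kappa; apply: leeD; last by apply: ereal_inf_lbound; exists z.
  apply: leeB; last by apply: ereal_sup_ubound; exists y.
  apply: (@le_trans _ _ (ereal_inf (range (fun x => (intKp K p x)%:E)))).
    by apply: ereal_inf_lbound; exists p.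
  by apply: ereal_inf_lbound; exists x => //; rewrite intKp_ckernel.
case E : (kappa K f) kpos bnd => [kap| |] // kpos bnd; last by have := bnd 0 0 0 0.
by exists kap => [|p x y z]; rewrite -?lte_fin// -lee_fin.
Qed.

Lemma condition_approximate_eigenfunction : condition_i K f \/ condition_ii K f ->
  [/\ K4 K f, exists A, forall x, `|a_ K f x| <= A & forall p (eta : R), 0 < eta ->
    exists phi lam, [/\ bounded_ucont phi, forall x, 1 <= phi x &
      forall x, `|convop (ckernel K p) phi x - a_ K f x * phi x - lam * phi x| <= eta * phi x]].
Proof.
case=> [[theta [Delta [k0 [r0 [[_ hK3 hK4 hK6] [hK7 hK8 hK9 hkap]]]]]]
       |[[theta [Delta [k0 [_ hK3 hK4 _ hK9]]]] [J KJ]]];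
  have [theta0 Delta0 k00 Klow Kup] := hK3;
  have auc := almost_periodic_ucont hK9 a_continuous;
  have [A aA] := almost_periodic_bounded hK9; split => //; try by exists A.
- have [kap kap0 kapP] := kappa_lower aA hkap; have [rD Kr0] := hK7.
  move=> p eta eta0; exact: (compact_support_approximate_eigenfunction K0 K1_integrable
    K1_bounded theta0 Delta0 k00 Klow Kup auc hK9 aA (lt_trans Delta0 rD) Kr0 hK8 hK6 kap0 kapP).
- move=> p eta eta0; exact: (convolution_approximate_eigenfunction K0 K1_integrable
    K1_bounded theta0 Delta0 k00 Klow Kup auc hK9 aA p KJ).
Qed.

(** The test function is the constant 1: the infimum over [r <= |x|] defining [k] is a subvalue on
    the half-line beyond [r]. *)
Lemma k_le_subvalue_bound p (h : R) :
  (forall r lam, subvalue K (a_ K f) p r lam -> lam <= h) -> (k_ K f p <= h%:E)%E.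
Proof.
(* The neighbourhood [V] contains every real beyond [M], so the infimum over [V] is at most the
   value at [M + 1]. *)
move=> sub; rewrite /k_ limf_einfE; apply: ge_ereal_sup => _ [V [M [_ hM]] <-].
pose r := M + 1.
set F := fun r : R => _.
apply: (@le_trans _ _ (F r)).
  by apply: ereal_inf_lbound; exists r => //; apply: hM; rewrite ltrDl.
have lo x : r <= `|x| -> (F r <= (\int[leb]_s ckernel K p x s - a_ K f x)%:E)%E.
  move=> rx; apply: ereal_inf_lbound; exists x => //=.
  by rewrite /intKexp /a_; congr _%:E; ring.
case E : (F r) lo => [l| |] lo; last by rewrite leNye.
- rewrite lee_fin; apply: (sub r); exists (cst 1).
    by apply: bounded_ucont_calA => //; exact: bounded_ucont_cst.
  move=> x; rewrite /halfline/= lte_fin => rx.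
  rewrite (@Lop_convop _ _ _ K1_integrable _ _ _ 1) ?normr1//; last first.
    by move=> y; rewrite normr1.
  rewrite /convop !mulr1; under int_ext do rewrite mulr1.
  rewrite -lee_fin; apply: lo; exact: le_trans (ltW rx) (ler_norm _).
- by have := lo `|r| (le_trans (ler_norm r) (ler_norm _)).
Qed.

End conditions.

Theorem theorem5p5 (R : realType) (K f : R -> R -> R)
  (K_ge0 : forall x y, 0 <= K x y)
  (f_nonlin : nonlinearity f)
  (cond : condition_i K f \/ condition_ii K f)
  (K_unif : forall phi : R -> R,
     bounded_fun phi -> continuous phi -> unif_continuous (Kop K phi)) :
  exists w : R, is_omega_low K (a_ K f) w /\ is_omega_up K (a_ K f) w.
Proof.
have hK1 : K1 K.
  by case: cond => [[? [? [? [? [[h _ _ _] _]]]]]|[[? [? [? [h _ _ _ _]]]] _]].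
have iK := K1_integrable hK1; have KM := K1_bounded hK1.
have [[_ hK4] [A aA] approx] := condition_approximate_eigenfunction K_ge0 f_nonlin hK1 cond.
have [h [lowE upE sub ch]] := H_real K_ge0 iK KM aA approx.
have k_le p := k_le_subvalue_bound hK1 (sub p).
pose F p := h (- p) * p^-1.
(* [k(-p) / p] is a lower bound for [F p] and tends to infinity at both ends of the half-line, so it
   eventually exceeds the threshold [F 1]. *)
have coerc (G : set_system R) : Filter G -> (\forall p \near G, 0 < p) ->
    ((k_ K f (-1 * p) * (p^-1)%:E)%E @[p --> G] --> +oo%E) ->
    \forall p \near G, F 1 <= F p.
  move=> FG G0 /cvgeyPge /(_ (F 1)) hG; near=> p.
  have p0 : 0 < p by near: p.
  rewrite -lee_fin; apply: (@le_trans _ _ (k_ K f (-1 * p) * (p^-1)%:E)%E); first by near: p.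
  rewrite /F EFinM mulN1r; apply: lee_wpmul2r; last exact: k_le.
  by rewrite lee_fin invr_ge0 ltW.
have [ky kz] := hK4 (-1) (or_intror erefl).
have [q q0 hq] : exists2 q, 0 < q & forall p, 0 < p -> F q <= F p.
  apply: coercive_min.
  - move=> p p0; apply: continuousM; last by apply: continuousV; rewrite ?gt_eqF.
    apply: continuous_comp; [exact: opp_continuous|exact: ch].
  - by apply: coerc => //; exact: nbhs_pinfty_gt.
  - by apply: coerc => //; exact: nbhs_right_gt.
(* Both eigenvalue limits equal [h], so one minimiser serves for both minima. *)
exists (F q); split; split.
- by exists q => //; rewrite lowE -EFinM.
- by move=> _ [p p0 <-]; rewrite lowE -EFinM lee_fin; exact: hq.
- by exists q => //; rewrite upE -EFinM.
- by move=> _ [p p0 <-]; rewrite upE -EFinM lee_fin; exact: hq.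
Unshelve. all: by end_near.
Qed.
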